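(* Let $k$ be a field of characteristic not $2$ and let $G$ be a finite group acting linearly on a finite-dimensional $k$-vector space $V$. Let $a_g: V\wedge V\to k$ (for all $g\in G$) and $[\cdot,\cdot]_{\mathfrak g}: V\wedge V\to V$ be linear maps. The quotient $$\mathcal{H}=T(V)\# G/\Big(v\otimes w-w\otimes v-[v,w]_{\mathfrak g}-\sum_{g\in G}a_g(v,w)\,g\ \Big|\ v,w\in V\Big)$$ defines a Lie orbifold algebra if and only if 1. the bracket $[\cdot,\cdot]_{\mathfrak g}$ endows $\mathfrak g:=V$ with the structure of a Lie algebra upon which $G$ acts as automorphisms; 2. the parameters $\{a_g\}_{g\in G}$ define a Drinfeld Hecke algebra; and 3. the Lie bracket structure is compatible with the Drinfeld Hecke algebra structure, i.e., for all $v_1,v_2,v_3\in V$ and $g\in G$, $$0=a_g(v_3,[v_1,v_2]_{\mathfrak g})+a_g(v_1,[v_2,v_3]_{\mathfrak g})+a_g(v_2,[v_3,v_1]_{\mathfrak g}).$$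
   Context: Write ${}^g v$ for the action of $g\in G$ on $v\in V$, extended to $S=S(V)$ and to the tensor algebra $T(V)$ by algebra automorphisms. For $A=S$ or $A=T(V)$, the skew group algebra $A\# G$ is $A\otimes kG$ with multiplication $(a\otimes g)(b\otimes h)=a\,({}^g b)\otimes gh$. Quotients of $T(V)\# G$ are filtered by assigning degree $1$ to each $v\in V$ and degree $0$ to each $g\in G$. Such a quotient by relations of the form $v\otimes w-w\otimes v-\kappa(v,w)$, $v,w\in V$, with $\kappa: V\wedge V\to (k\oplus V)\otimes kG$ linear, satisfies the PBW condition when its associated graded algebra is isomorphic (as a graded algebra) to $S\# G$. The algebra $\mathcal{H}$ in the claim is called a Lie orbifold algebra when it satisfies the PBW condition. The parameters $\{a_g\}_{g\in G}$ define a Drinfeld Hecke algebra when the quotient $T(V)\# G/(v\otimes w-w\otimes v-\sum_{g\in G}a_g(v,w)g\mid v,w\in V)$ satisfies the PBW condition. *)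

(* Defs.v *)
From HB Require Import structures.
From mathcomp Require Import fingroup all_boot all_order all_algebra.
From mathcomp Require Import boolp.
From mathcomp Require Import finmap monalg.

Set Implicit Arguments.
Unset Strict Implicit.
Unset Printing Implicit Defensive.

Import GRing.Theory.
Local Open Scope ring_scope.
Local Open Scope quotient_scope.

Section SubQuotient.
Variables (k : fieldType) (U : lmodType k) (W : submodClosed U).

Definition subsp := {x : U | x \in W}.
HB.instance Definition _ := [isSub of subsp for @sval U (fun x => x \in W)].
HB.instance Definition _ := [Choice of subsp by <:].
HB.instance Definition _ := [SubChoice_isSubLmodule of subsp by <:].

Lemma subsp_valB (x y : subsp) : \val (x - y) = \val x - \val y.
Proof. exact: raddfB. Qed.

Definition zmod_of_submod : {pred U} := W.
Fact zmod_of_submodB : zmod_closed zmod_of_submod.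
Proof.
have [W0 WD] := GRing.rpred0D W.
by split=> // x y Wx Wy; rewrite -scaleN1r WD // rpredZ.
Qed.
HB.instance Definition _ :=
  GRing.isZmodClosed.Build U zmod_of_submod zmod_of_submodB.

Definition qspace := {ideal_quot zmod_of_submod}.
HB.instance Definition _ := GRing.Zmodule.on qspace.
HB.instance Definition _ := EqQuotient.on qspace.

Definition qproj (x : U) : qspace := \pi_qspace x.
Definition qscale (c : k) (x : qspace) : qspace := qproj (c *: repr x).

Lemma qprojP x y : reflect (qproj x = qproj y) (x - y \in W).
Proof. by rewrite (Quotient.idealrBE zmod_of_submod); apply: eqP. Qed.

Lemma qprojD x y : qproj (x + y) = qproj x + qproj y.
Proof. by rewrite /qproj !piE. Qed.

Lemma qproj_repr (x : qspace) : qproj (repr x) = x.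
Proof. exact: reprK. Qed.

Lemma repr_qproj x : repr (qproj x) - x \in W.
Proof. by apply/qprojP; rewrite qproj_repr. Qed.

Lemma qscale_proj c x : qscale c (qproj x) = qproj (c *: x).
Proof. by apply/qprojP; rewrite -scalerBr rpredZ ?repr_qproj. Qed.

Fact qscaleA a b v : qscale a (qscale b v) = qscale (a * b) v.
Proof. by rewrite -[v]qproj_repr !qscale_proj scalerA. Qed.
Fact qscale1 : left_id 1 qscale.
Proof. by move=> v; rewrite -[v]qproj_repr qscale_proj scale1r. Qed.
Fact qscaleDr : right_distributive qscale +%R.
Proof.
move=> a x y; rewrite -[x]qproj_repr -[y]qproj_repr -qprojD !qscale_proj.
by rewrite scalerDr qprojD.
Qed.
Fact qscaleDl v : {morph qscale^~ v : a b / a + b}.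
Proof.
by move=> a b; rewrite -[v]qproj_repr !qscale_proj scalerDl qprojD.
Qed.
HB.instance Definition _ := GRing.Zmodule_isLmodule.Build k qspace
  qscaleA qscale1 qscaleDr qscaleDl.

End SubQuotient.

(* Underlying data of an N-graded algebra: components, unit, products.  The laws *)
(* are not recorded, since an isomorphism of graded algebras is a bijective     *)
(* degreewise linear map preserving this data.                                  *)
Record gradedAlg (k : fieldType) := GradedAlg {
  gcomp :> nat -> lmodType k;
  gone : gcomp 0;
  gmul : forall i j, gcomp i -> gcomp j -> gcomp (i + j)
}.

Definition graded_isomorphic (k : fieldType) (A B : gradedAlg k) : Prop :=
  exists phi : forall i, {linear A i -> B i},
    [/\ forall i, bijective (phi i),
        phi 0 (gone A) = gone B
      & forall i j (x : A i) (y : A j),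
          phi (i + j)%N (gmul x y) = gmul (phi i x) (phi j y)].

(* Filtrations are indexed with a shift, fil n being the part of degree < n,    *)
(* so that the associated graded component of degree n is fil n.+1 / fil n,     *)
(* also for n = 0.                                                              *)
Record filtration (k : fieldType) (R : algType k) := Filtration {
  fil :> nat -> submodClosed R;
  fil1 : 1 \in fil 1;
  filS : forall n x, x \in fil n -> x \in fil n.+1;
  filM : forall m n x y,
    x \in fil m.+1 -> y \in fil n.+1 -> x * y \in fil (m + n).+1;
  filMl : forall m n x y,
    x \in fil m -> y \in fil n.+1 -> x * y \in fil (m + n);
  filMr : forall m n x y,
    x \in fil m.+1 -> y \in fil n -> x * y \in fil (m + n)
}.

Section QuotientAlgebra.
Variables (k : fieldType) (R : algType k) (X : R -> Prop).

Inductive ideal_gen : R -> Prop :=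
| IdealGen x : X x -> ideal_gen x
| Ideal0 : ideal_gen 0
| IdealD x y : ideal_gen x -> ideal_gen y -> ideal_gen (x + y)
| IdealMl a x : ideal_gen x -> ideal_gen (a * x)
| IdealMr a x : ideal_gen x -> ideal_gen (x * a).

Definition idealp : {pred R} := fun x => `[< ideal_gen x >].

Fact idealp_submod : submod_closed idealp.
Proof.
split; first by apply/asboolP; apply: Ideal0.
move=> c x y /asboolP Ix /asboolP Iy; apply/asboolP; apply: IdealD => //.
by rewrite -mulr_algl; apply: IdealMl.
Qed.
HB.instance Definition _ := GRing.isSubmodClosed.Build k R idealp idealp_submod.

Lemma idealpMl a x : x \in idealp -> a * x \in idealp.
Proof. by move=> /asboolP Ix; apply/asboolP; apply: IdealMl. Qed.
Lemma idealpMr a x : x \in idealp -> x * a \in idealp.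
Proof. by move=> /asboolP Ix; apply/asboolP; apply: IdealMr. Qed.

(* Only a possibly trivial ring: the ideal generated by X may be all of R, and  *)
(* mathcomp's algType requires 1 != 0.                                          *)
Definition qalg := qspace idealp.
HB.instance Definition _ := GRing.Lmodule.on qalg.

Definition qalg_proj (x : R) : qalg := qproj idealp x.
Definition qalg_mul (x y : qalg) : qalg := qalg_proj (repr x * repr y).

Lemma qalg_mul_proj x y :
  qalg_mul (qalg_proj x) (qalg_proj y) = qalg_proj (x * y).
Proof.
apply/qprojP; set x' := repr _; set y' := repr _.
have -> : x' * y' - x * y = (x' - x) * y' + x * (y' - y).
  by rewrite mulrBl mulrBr addrA subrK.
by apply: rpredD; [apply: idealpMr | apply: idealpMl]; apply: repr_qproj.
Qed.

Lemma qalgP (x : qalg) : exists y, x = qalg_proj y.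
Proof. by exists (repr x); rewrite /qalg_proj qproj_repr. Qed.

Lemma qalg_projD x y : qalg_proj (x + y) = qalg_proj x + qalg_proj y.
Proof. exact: qprojD. Qed.

Fact qalg_mulA : associative qalg_mul.
Proof.
move=> x y z; have [[x' ->] [y' ->] [z' ->]] := And3 (qalgP x) (qalgP y) (qalgP z).
by rewrite !qalg_mul_proj mulrA.
Qed.
Fact qalg_mul1x : left_id (qalg_proj 1) qalg_mul.
Proof. by move=> x; have [x' ->] := qalgP x; rewrite qalg_mul_proj mul1r. Qed.
Fact qalg_mulx1 : right_id (qalg_proj 1) qalg_mul.
Proof. by move=> x; have [x' ->] := qalgP x; rewrite qalg_mul_proj mulr1. Qed.
Fact qalg_mulDl : left_distributive qalg_mul +%R.
Proof.
move=> x y z; have [[x' ->] [y' ->] [z' ->]] := And3 (qalgP x) (qalgP y) (qalgP z).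
by rewrite -qalg_projD !qalg_mul_proj mulrDl qalg_projD.
Qed.
Fact qalg_mulDr : right_distributive qalg_mul +%R.
Proof.
move=> x y z; have [[x' ->] [y' ->] [z' ->]] := And3 (qalgP x) (qalgP y) (qalgP z).
by rewrite -qalg_projD !qalg_mul_proj mulrDr qalg_projD.
Qed.
HB.instance Definition _ := GRing.Zmodule_isPzRing.Build qalg
  qalg_mulA qalg_mul1x qalg_mulx1 qalg_mulDl qalg_mulDr.

Lemma qalg_projM x y : qalg_proj (x * y) = qalg_proj x * qalg_proj y.
Proof. by rewrite -qalg_mul_proj. Qed.

Variable F : filtration R.

(* The quotient filtration: images of the pieces of F. *)
Definition qfil n : {pred qalg} :=
  fun x => `[< exists2 y, y \in F n & qalg_proj y = x >].

Fact qfil_submod n : submod_closed (qfil n).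
Proof.
split; first by apply/asboolP; exists 0; rewrite ?rpred0 //= /qalg_proj /qproj piE.
move=> c _ _ /asboolP[x Fx <-] /asboolP[y Fy <-]; apply/asboolP.
exists (c *: x + y); first by rewrite rpredD ?rpredZ.
rewrite [LHS]qprojD; congr (_ + _); symmetry; exact: qscale_proj.
Qed.
HB.instance Definition _ n :=
  GRing.isSubmodClosed.Build k qalg (qfil n) (qfil_submod n).

Lemma qfilM m n x y :
  x \in qfil m.+1 -> y \in qfil n.+1 -> x * y \in qfil (m + n).+1.
Proof.
move=> /asboolP[x' Fx <-] /asboolP[y' Fy <-]; apply/asboolP.
by exists (x' * y'); rewrite ?filM ?qalg_projM.
Qed.
Lemma qfilMl m n x y :
  x \in qfil m -> y \in qfil n.+1 -> x * y \in qfil (m + n).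
Proof.
move=> /asboolP[x' Fx <-] /asboolP[y' Fy <-]; apply/asboolP.
by exists (x' * y'); rewrite ?filMl ?qalg_projM.
Qed.
Lemma qfilMr m n x y :
  x \in qfil m.+1 -> y \in qfil n -> x * y \in qfil (m + n).
Proof.
move=> /asboolP[x' Fx <-] /asboolP[y' Fy <-]; apply/asboolP.
by exists (x' * y'); rewrite ?filMr ?qalg_projM.
Qed.
Fact qfil1 : 1 \in qfil 1.
Proof. by apply/asboolP; exists 1; rewrite ?fil1. Qed.

Definition qfil_prev n : {pred subsp (qfil n.+1)} := fun x => \val x \in qfil n.
Arguments qfil_prev : clear implicits.

Fact qfil_prev_submod n : submod_closed (qfil_prev n).
Proof.
split; first by rewrite unfold_in raddf0 rpred0.
by move=> c x y Fx Fy; rewrite unfold_in linearP rpredD ?rpredZ.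
Qed.
HB.instance Definition _ n :=
  GRing.isSubmodClosed.Build k (subsp (qfil n.+1)) (qfil_prev n)
    (qfil_prev_submod n).

(* qfil n.+1 / qfil n, i.e. degree at most n modulo degree less than n *)
Definition gr_comp n : lmodType k := qspace (qfil_prev n).

Definition gr_sym n x (Fx : x \in qfil n.+1) : gr_comp n :=
  qproj (qfil_prev n) (Sub x Fx).

(* The product of classes, through representatives; independence of the choice  *)
(* is gr_mul_sym.                                                               *)
Definition gr_mul m n (x : gr_comp m) (y : gr_comp n) : gr_comp (m + n) :=
  gr_sym (qfilM (valP (repr x)) (valP (repr y))).

Definition assoc_graded : gradedAlg k :=
  @GradedAlg k gr_comp (gr_sym qfil1) gr_mul.

Lemma gr_symP n x y (Fx : x \in qfil n.+1) (Fy : y \in qfil n.+1) :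
  reflect (gr_sym Fx = gr_sym Fy) (x - y \in qfil n).
Proof.
have <- : (Sub x Fx - Sub y Fy \in qfil_prev n) = (x - y \in qfil n).
  by rewrite unfold_in subsp_valB.
exact: qprojP.
Qed.

Lemma gr_symE n (x : gr_comp n) : gr_sym (valP (repr x)) = x.
Proof.
rewrite -[RHS]qproj_repr; congr qproj; apply: val_inj; exact: SubK.
Qed.

Lemma repr_gr_sym n x (Fx : x \in qfil n.+1) :
  \val (repr (gr_sym Fx)) - x \in qfil n.
Proof. by apply/(gr_symP (valP _) Fx); rewrite gr_symE. Qed.

Lemma gr_mul_sym m n x y (Fx : x \in qfil m.+1) (Fy : y \in qfil n.+1) :
  gr_mul (gr_sym Fx) (gr_sym Fy) = gr_sym (qfilM Fx Fy).
Proof.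
apply/gr_symP; move: (repr_gr_sym Fx) (repr_gr_sym Fy) (valP (repr (gr_sym Fy))).
move: (\val _) => x'; move: (\val _) => y' hx hy Fy'.
have -> : x' * y' - x * y = (x' - x) * y' + x * (y' - y).
  by rewrite mulrBl mulrBr addrA subrK.
by rewrite rpredD ?(qfilMl hx Fy') ?(qfilMr Fx hy).
Qed.

End QuotientAlgebra.

Section Skew.
Variables (k : fieldType) (G : finGroupType) (A : algType k).

Record algAction := AlgAction {
  aact :> G -> {lrmorphism A -> A};
  aact1 : forall x, aact 1%g x = x;
  aactM : forall g h x, aact (g * h)%g x = aact g (aact h x)
}.

(* A # G: the function x stands for the tensor \sum_g (x g) (x) g, see skewE;    *)
(* skew_mul_tens is the defining rule of the product.                           *)
Definition skewAlg of algAction : Type := {ffun G -> A}.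

Variable alpha : algAction.
Local Notation skew := (skewAlg alpha).

HB.instance Definition _ := GRing.Lmodule.on skew.

Definition skew_tens (a : A) (g : G) : skew := [ffun h => if h == g then a else 0].

Definition skew_mul (x y : skew) : skew :=
  [ffun h => \sum_(g : G) x g * alpha g (y (g^-1 * h)%g)].

Lemma skewP (x y : skew) : (forall g, x g = y g) <-> x = y.
Proof. by split=> [xy|->//]; apply/ffunP. Qed.

Lemma skewD (x y : skew) g : (x + y) g = x g + y g.
Proof. by rewrite ffunE. Qed.

Lemma skewZ c (x : skew) g : (c *: x) g = c *: x g.
Proof. by rewrite ffunE. Qed.

Lemma skewE (x : skew) : x = \sum_(g : G) skew_tens (x g) g.
Proof.
apply/ffunP=> h; rewrite sum_ffunE (bigD1 h) //= ffunE eqxx big1 ?addr0 // => g.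
by rewrite ffunE eq_sym => /negPf->.
Qed.

Lemma skew_mul_tens a g b h :
  skew_mul (skew_tens a g) (skew_tens b h) = skew_tens (a * alpha g b) (g * h)%g.
Proof.
apply/ffunP=> u; rewrite !ffunE (bigD1 g) //= big1 ?addr0; last first.
  by move=> i /negPf ig; rewrite !ffunE ig mul0r.
rewrite !ffunE eqxx; have -> : (g^-1 * u == h)%g = (u == g * h)%g.
  by rewrite -(inj_eq (mulgI g)) mulKVg.
by case: eqP => // _; rewrite raddf0 mulr0.
Qed.

Fact skew_mulA : associative skew_mul.
Proof.
move=> x y z; apply/ffunP=> h; rewrite !ffunE.
under eq_bigr do rewrite ffunE raddf_sum mulr_sumr.
under [RHS]eq_bigr do rewrite ffunE mulr_suml.
rewrite [RHS]exchange_big; apply: eq_bigr => g _ /=.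
rewrite (reindex_inj (mulgI g^-1%g)) /=; apply: eq_bigr => u _.
have -> : ((g^-1 * u)^-1 * (g^-1 * h) = u^-1 * h)%g.
  by rewrite invMg invgK -mulgA mulKVg.
have := aactM alpha g (g^-1 * u)%g (z (u^-1 * h)%g); rewrite mulKVg => e.
by rewrite rmorphM mulrA; congr (_ * _); rewrite e.
Qed.

Fact skew_mul1x : left_id (skew_tens 1 1%g) skew_mul.
Proof.
move=> x; apply/ffunP=> h; rewrite ffunE (bigD1 1%g) //= ffunE eqxx mul1r.
rewrite invg1 mul1g aact1 big1 ?addr0 // => g /negPf g1.
by rewrite ffunE g1 mul0r.
Qed.

Fact skew_mulx1 : right_id (skew_tens 1 1%g) skew_mul.
Proof.
move=> x; apply/ffunP=> h; rewrite ffunE (bigD1 h) //= ffunE mulVg eqxx.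
rewrite rmorph1 mulr1 big1 ?addr0 // => g /negPf gh.
by rewrite ffunE -eq_invg_mul invgK gh raddf0 mulr0.
Qed.

Fact skew_mulDl : left_distributive skew_mul +%R.
Proof.
move=> x y z; apply/ffunP=> h; rewrite skewD !ffunE -big_split.
by apply: eq_bigr => g _ /=; rewrite skewD mulrDl.
Qed.

Fact skew_mulDr : right_distributive skew_mul +%R.
Proof.
move=> x y z; apply/ffunP=> h; rewrite skewD !ffunE -big_split.
by apply: eq_bigr => g _ /=; rewrite skewD raddfD mulrDr.
Qed.

Fact skew_1neq0 : skew_tens 1 1%g != 0.
Proof.
apply/eqP => /ffunP/(_ 1%g); rewrite !ffunE eqxx => /eqP; apply/negP.
exact: oner_neq0.
Qed.

HB.instance Definition _ := GRing.Zmodule_isNzRing.Build skew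
  skew_mulA skew_mul1x skew_mulx1 skew_mulDl skew_mulDr skew_1neq0.

Fact skew_scaleAl (c : k) (x y : skew) : c *: (x * y) = (c *: x) * y.
Proof.
apply/ffunP=> h; rewrite skewZ !ffunE scaler_sumr.
by apply: eq_bigr => g _; rewrite skewZ scalerAl.
Qed.
HB.instance Definition _ := GRing.Lmodule_isLalgebra.Build k skew skew_scaleAl.

Fact skew_scaleAr (c : k) (x y : skew) : c *: (x * y) = x * (c *: y).
Proof.
apply/ffunP=> h; rewrite skewZ !ffunE scaler_sumr.
by apply: eq_bigr => g _; rewrite skewZ linearZ scalerAr.
Qed.
HB.instance Definition _ := GRing.Lalgebra_isAlgebra.Build k skew skew_scaleAr.

Definition skew_pred (W : {pred A}) : {pred skew} :=
  fun x => [forall g, x g \in W].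

Lemma skew_predP (W : {pred A}) (x : skew) :
  reflect (forall g, x g \in W) (x \in skew_pred W).
Proof. exact: forallP. Qed.

Fact skew_pred_submod (W : submodClosed A) : submod_closed (skew_pred W).
Proof.
split; first by apply/skew_predP=> g; rewrite ffunE (rpred0 W).
move=> c x y /skew_predP Wx /skew_predP Wy; apply/skew_predP=> g.
by rewrite skewD skewZ rpredD ?rpredZ.
Qed.
HB.instance Definition _ (W : submodClosed A) :=
  GRing.isSubmodClosed.Build k skew (skew_pred W) (skew_pred_submod W).

Lemma skew_predM (W1 W2 W3 : submodClosed A) :
    (forall x y, x \in W1 -> y \in W2 -> x * y \in W3) ->
    (forall g x, x \in W2 -> alpha g x \in W2) ->
  forall x y, x \in skew_pred W1 -> y \in skew_pred W2 -> x * y \in skew_pred W3.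
Proof.
move=> WM Wact x y /skew_predP Wx /skew_predP Wy; apply/skew_predP=> g.
by rewrite ffunE rpred_sum // => h _; apply: WM => //; apply: Wact.
Qed.

End Skew.

Section MalgSupport.
Variables (k : fieldType) (M : monomType) (mf : measure M).
Implicit Types (D E F : pred nat) (x y : {malg k[M]}).

Definition deg_in D : {pred {malg k[M]}} := fun x => all (fun m => D (mf m)) (msupp x).

Lemma deg_inP D x :
  reflect (forall m, x@_m != 0 -> D (mf m)) (x \in deg_in D).
Proof.
by apply: (iffP allP) => h m; [rewrite mcoeff_neq0|rewrite -mcoeff_neq0]; apply: h.
Qed.

Fact deg_in_submod D : submod_closed (deg_in D).
Proof.
split; first by apply/deg_inP=> m; rewrite mcoeff0 eqxx.
move=> c x y /deg_inP Dx /deg_inP Dy; apply/deg_inP=> m; rewrite mcoeffD mcoeffZ.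
by have [->|/Dx//] := eqVneq (x@_m) 0; rewrite mulr0 add0r; apply: Dy.
Qed.
HB.instance Definition _ D :=
  GRing.isSubmodClosed.Build k {malg k[M]} (deg_in D) (deg_in_submod D).

Lemma deg_inU D m : D (mf m) -> << m >> \in deg_in D.
Proof.
move=> Dm; apply/deg_inP=> m'; rewrite mcoeffU.
by have [<-//|_] := eqVneq m m'; rewrite mulr0n eqxx.
Qed.

Lemma deg_in1 D : D 0%N -> 1 \in deg_in D.
Proof. by move=> D0; apply: deg_inU; rewrite mf0. Qed.

Lemma deg_inM D E F x y :
    (forall i j, D i -> E j -> F (i + j)%N) ->
  x \in deg_in D -> y \in deg_in E -> x * y \in deg_in F.
Proof.
move=> DEF /deg_inP Dx /deg_inP Ey; apply/deg_inP=> m; rewrite mcoeff_neq0.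
move=> /msuppM_le[m1 [m2 [m1x m2y ->]]]; rewrite mfM; apply: DEF.
  by apply: Dx; rewrite mcoeff_neq0.
by apply: Ey; rewrite mcoeff_neq0.
Qed.

End MalgSupport.

Lemma malgUZ (k : fieldType) (M : monomType) (c : k) (m : M) :
  << c *g m >> = c *: << m >> :> {malg k[M]}.
Proof. by apply/malgP=> m'; rewrite mcoeffZ !mcoeffU mulrnAr mulr1. Qed.

Section MalgLift.
Variables (k : fieldType) (M : monomType) (A : algType k) (h : {mmorphism M -> A}).

Definition malg_lift : {malg k[M]} -> A := mmap (in_alg A) h.

Fact malg_lift_is_additive : additive malg_lift.
Proof. exact: raddfB. Qed.
Fact malg_lift_is_multiplicative : multiplicative malg_lift.
Proof.
apply: commr_mmap_is_multiplicative => g m m' /=.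
by rewrite /GRing.comm mulr_algl mulr_algr.
Qed.
Fact malg_lift_is_scalable : scalable malg_lift.
Proof. by move=> c x; rewrite /malg_lift mmapZ mulr_algl. Qed.
HB.instance Definition _ := GRing.isAdditive.Build _ _ malg_lift malg_lift_is_additive.
HB.instance Definition _ :=
  GRing.isMultiplicative.Build _ _ malg_lift malg_lift_is_multiplicative.
HB.instance Definition _ :=
  GRing.isScalable.Build _ _ _ _ malg_lift malg_lift_is_scalable.

Lemma malg_liftU m : malg_lift << m >> = h m.
Proof. by rewrite /malg_lift mmapU /= scale1r mul1r. Qed.

Lemma malg_lift_uniq (f : {lrmorphism {malg k[M]} -> A}) :
  (forall m, f << m >> = h m) -> f =1 malg_lift.
Proof.
move=> fh x; rewrite [x]monalgE !raddf_sum; apply: eq_bigr => m _.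
by rewrite malgUZ [LHS]linearZ [RHS]linearZ /= fh malg_liftU.
Qed.

Lemma malg_lift_deg (mf : measure M) (W : submodClosed A) (D : pred nat) x :
    (forall m, D (mf m) -> h m \in W) ->
  x \in deg_in mf D -> malg_lift x \in W.
Proof.
move=> hW /allP Dx; rewrite /malg_lift /mmap big_seq rpred_sum // => m mx.
by rewrite mulr_algl rpredZ ?hW ?Dx.
Qed.
End MalgLift.

Section TensorAlgebra.
Variables (k : fieldType) (V : vectType k).

(* T(V) as the free algebra on the basis vbasis {:V} of V.  That it does not     *)
(* depend on the basis is the universal property: tensor_lift_vec and           *)
(* tensor_lift_uniq.                                                            *)
Definition tensorAlg := {malg k[{fmonom 'I_(\dim {:V})}]}.
HB.instance Definition _ := GRing.Lalgebra.on tensorAlg.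

Fact tensor_scaleAr (c : k) (x y : tensorAlg) : c *: (x * y) = x * (c *: y).
Proof.
suff mulC : x * c%:MP = c *: x by rewrite -[c *: y]mul_malgC mulrA mulC scalerAl.
rewrite [x]monalgE mulr_suml [RHS]scaler_sumr; apply: eq_bigr => m _.
rewrite [LHS]fgmulUU mulm1 mulrC.
by apply/malgP => m'; rewrite mcoeffZ !mcoeffU mulrnAr.
Qed.
HB.instance Definition _ := GRing.Lalgebra_isAlgebra.Build k tensorAlg tensor_scaleAr.

Definition tensor_vec (v : V) : tensorAlg := \sum_i coord (vbasis {:V}) i v *: << fmu i >>.

Lemma basis_sum (v : V) : v = \sum_i coord (vbasis {:V}) i v *: (vbasis {:V})`_i.
Proof. exact/coord_vbasis/memvf. Qed.

Fact tensor_vec_linear : linear tensor_vec.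
Proof.
move=> c u v; rewrite /tensor_vec scaler_sumr -big_split; apply: eq_bigr => i _.
by rewrite linearP scalerDl scalerA.
Qed.
HB.instance Definition _ := GRing.isLinear.Build k V tensorAlg _ tensor_vec
  tensor_vec_linear.

Lemma tensor_vec_basis (i : 'I_(\dim {:V})) : tensor_vec (vbasis {:V})`_i = << fmu i >>.
Proof.
have vfree := basis_free (vbasisP {:V}).
rewrite /tensor_vec (bigD1 i) //= coord_free // eqxx scale1r big1 ?addr0 // => j.
by rewrite coord_free // eq_sym => /negPf->; rewrite scale0r.
Qed.

Section Lift.
Variables (A : algType k) (f : {linear V -> A}).

Definition tensor_word (m : {fmonom 'I_(\dim {:V})}) : A :=
  \prod_(i <- m) f ((vbasis {:V})`_i).
Fact tensor_word_mul : mmorphism tensor_word.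
Proof.
split=> [m1 m2|]; rewrite /tensor_word; first by rewrite fmM big_cat.
by rewrite fm1 big_nil.
Qed.
HB.instance Definition _ := isMultiplicative.Build _ _ tensor_word tensor_word_mul.

Lemma tensor_wordU i : tensor_word (fmu i) = f (vbasis {:V})`_i.
Proof. by rewrite /tensor_word fmU big_seq1. Qed.

Definition tensor_lift : {lrmorphism tensorAlg -> A} := malg_lift tensor_word.

Lemma tensor_lift_vec v : tensor_lift (tensor_vec v) = f v.
Proof.
rewrite [in RHS](basis_sum v) !linear_sum; apply: eq_bigr => i _.
by rewrite [LHS]linearZ [RHS]linearZ /= malg_liftU; congr (_ *: _); apply: tensor_wordU.
Qed.

Lemma tensor_lift_uniq (phi : {lrmorphism tensorAlg -> A}) :
  (forall v, phi (tensor_vec v) = f v) -> phi =1 tensor_lift.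
Proof.
move=> phif; apply: malg_lift_uniq => -[m]; change (phi << FMonom m >> = tensor_word (FMonom m)).
rewrite /tensor_word /=; elim: m => [|i m IHm] /=.
  by rewrite big_nil -(rmorph1 phi); congr (phi << _ >>); apply/val_inj; rewrite /= fm1.
have -> : << FMonom (i :: m) >> = tensor_vec ((vbasis {:V})`_i) * << FMonom m >> :> tensorAlg.
  rewrite tensor_vec_basis [RHS]fgmulUU mulr1; congr (<< _ >>).
  by apply/val_inj; rewrite /= fmM fmU.
by rewrite [LHS]rmorphM big_cons -IHm -phif.
Qed.

End Lift.
End TensorAlgebra.

Section CmonomDecomposition.
Variable n : nat.
Implicit Types (m : {cmonom 'I_n}) (i : 'I_n).

Let ucmX i a : {cmonom 'I_n} := iter a (mmul (ucm i)) mone.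

Let ucmXE i a j : ucmX i a j = ((i == j) * a)%N.
Proof.
elim: a => [|a IHa] /=; first by rewrite muln0 cm1.
by rewrite cmM cmU IHa mulnS.
Qed.

Let cmonom_prod m : m = \big[mmul/mone]_i ucmX i (m i).
Proof.
apply/eqP/cmP => j; rewrite (big_morph (fun m' : {cmonom 'I_n} => m' j)
  (id1 := 0%N) (op1 := addn)) => [|m1 m2|]; rewrite ?cm1 ?cmM //.
rewrite (bigD1 j) //= ucmXE eqxx mul1n big1 ?addn0 // => i /negPf ij.
by rewrite ucmXE ij.
Qed.

Lemma mdeg_sum m : mdeg m = (\sum_i m i)%N.
Proof.
rewrite [in LHS](cmonom_prod m) mdeg_prod; apply: eq_bigr => i _.
elim: (m i) => [|a IHa]; first exact: mdeg1.
by rewrite /= mdegM mdegU IHa.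
Qed.

Lemma malgU_cmonom (k : fieldType) m :
  << m >> = \prod_i << ucm i >> ^+ m i :> {malg k[{cmonom 'I_n}]}.
Proof.
rewrite [in LHS](cmonom_prod m) (big_morph (fun m' => << m' >> : {malg k[{cmonom 'I_n}]})
  (id1 := 1) (op1 := *%R)) // => [|m1 m2]; last by rewrite [RHS]fgmulUU mulr1.
apply: eq_bigr => i _; elim: (m i) => [|a IHa] //.
by rewrite exprS -IHa [RHS]fgmulUU mulr1.
Qed.

End CmonomDecomposition.

Section SymmetricAlgebra.
Variables (k : fieldType) (V : vectType k).

(* S(V) as the polynomial algebra on the same basis; universal property in      *)
(* sym_lift_vec and sym_lift_uniq.                                              *)
Definition symAlg := {malg k[{cmonom 'I_(\dim {:V})}]}.
HB.instance Definition _ := GRing.ComAlgebra.on symAlg.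

Definition sym_vec (v : V) : symAlg := \sum_i coord (vbasis {:V}) i v *: << ucm i >>.

Fact sym_vec_linear : linear sym_vec.
Proof.
move=> c u v; rewrite /sym_vec scaler_sumr -big_split; apply: eq_bigr => i _.
by rewrite linearP scalerDl scalerA.
Qed.
HB.instance Definition _ := GRing.isLinear.Build k V symAlg _ sym_vec
  sym_vec_linear.

Lemma sym_vec_basis (i : 'I_(\dim {:V})) : sym_vec (vbasis {:V})`_i = << ucm i >>.
Proof.
have vfree := basis_free (vbasisP {:V}).
rewrite /sym_vec (bigD1 i) //= coord_free // eqxx scale1r big1 ?addr0 // => j.
by rewrite coord_free // eq_sym => /negPf->; rewrite scale0r.
Qed.

Section Lift.
Variables (A : comAlgType k) (f : {linear V -> A}).

Definition sym_word (m : {cmonom 'I_(\dim {:V})}) : A :=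
  \prod_(i : 'I_(\dim {:V})) f (vbasis {:V})`_i ^+ m i.
Fact sym_word_mul : mmorphism sym_word.
Proof.
split=> [m1 m2|]; rewrite /sym_word; last by rewrite big1 // => i _; rewrite cm1.
by rewrite -big_split; apply: eq_bigr => i _; rewrite cmM exprD.
Qed.
HB.instance Definition _ := isMultiplicative.Build _ _ sym_word sym_word_mul.

Lemma sym_wordU i : sym_word (ucm i) = f (vbasis {:V})`_i.
Proof.
rewrite /sym_word (bigD1 i) //= cmUU expr1 big1 ?mulr1 // => j /negPf ij.
by rewrite cmU eq_sym ij.
Qed.

Definition sym_lift : {lrmorphism symAlg -> A} := malg_lift sym_word.

Lemma sym_lift_vec v : sym_lift (sym_vec v) = f v.
Proof.
rewrite [in RHS](basis_sum v) !linear_sum; apply: eq_bigr => i _.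
by rewrite [LHS]linearZ [RHS]linearZ /= malg_liftU; congr (_ *: _); apply: sym_wordU.
Qed.

Lemma sym_lift_uniq (phi : {lrmorphism symAlg -> A}) :
  (forall v, phi (sym_vec v) = f v) -> phi =1 sym_lift.
Proof.
move=> phif; apply: malg_lift_uniq => m; change (phi << m >> = sym_word m).
have -> : << m >> = \prod_(i : 'I_(\dim {:V})) sym_vec (vbasis {:V})`_i ^+ m i :> symAlg.
  under eq_bigr do rewrite sym_vec_basis.
  exact: malgU_cmonom.
by rewrite rmorph_prod; apply: eq_bigr => i _; rewrite -phif -rmorphXn.
Qed.

End Lift.
End SymmetricAlgebra.

Section InducedActions.
Variables (k : fieldType) (G : finGroupType) (V : vectType k).

(* A homomorphism G -> GL(V), as a left action. *)
Record linAction := LinAction {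
  lact :> G -> 'End(V);
  lact1 : lact 1%g = \1%VF;
  lactM : forall g h, lact (g * h)%g = (lact g \o lact h)%VF
}.

Variable rho : linAction.

Lemma tensor_ext (A : algType k) (p q : {lrmorphism tensorAlg V -> A}) :
  (forall v, p (tensor_vec v) = q (tensor_vec v)) -> p =1 q.
Proof.
move=> pq x; rewrite (@tensor_lift_uniq _ _ _ (p \o @tensor_vec k V) p) //.
by rewrite -(@tensor_lift_uniq _ _ _ (p \o @tensor_vec k V) q) // => v; rewrite /= pq.
Qed.

Lemma sym_ext (A : comAlgType k) (p q : {lrmorphism symAlg V -> A}) :
  (forall v, p (sym_vec v) = q (sym_vec v)) -> p =1 q.
Proof.
move=> pq x; rewrite (@sym_lift_uniq _ _ _ (p \o @sym_vec k V) p) //.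
by rewrite -(@sym_lift_uniq _ _ _ (p \o @sym_vec k V) q) // => v; rewrite /= pq.
Qed.

Definition tensor_act (g : G) : {lrmorphism tensorAlg V -> tensorAlg V} :=
  tensor_lift (@tensor_vec k V \o rho g).
Definition sym_act (g : G) : {lrmorphism symAlg V -> symAlg V} :=
  sym_lift (@sym_vec k V \o rho g).

Lemma tensor_act_vec g v : tensor_act g (tensor_vec v) = tensor_vec (rho g v).
Proof. by rewrite tensor_lift_vec. Qed.
Lemma sym_act_vec g v : sym_act g (sym_vec v) = sym_vec (rho g v).
Proof. by rewrite sym_lift_vec. Qed.

Fact tensor_act1 x : tensor_act 1%g x = x.
Proof.
apply: (tensor_ext (q := idfun)) => v.
by rewrite tensor_act_vec lact1 id_lfunE.
Qed.
Fact tensor_actM g h x : tensor_act (g * h)%g x = tensor_act g (tensor_act h x).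
Proof.
apply: (tensor_ext (q := tensor_act g \o tensor_act h)) => v.
rewrite tensor_act_vec lactM comp_lfunE.
by rewrite -[LHS]tensor_act_vec -[X in tensor_act g X]tensor_act_vec.
Qed.
Fact sym_act1 x : sym_act 1%g x = x.
Proof. by apply: (sym_ext (q := idfun)) => v; rewrite sym_act_vec lact1 id_lfunE. Qed.
Fact sym_actM g h x : sym_act (g * h)%g x = sym_act g (sym_act h x).
Proof.
apply: (sym_ext (q := sym_act g \o sym_act h)) => v.
rewrite sym_act_vec lactM comp_lfunE.
by rewrite -[LHS]sym_act_vec -[X in sym_act g X]sym_act_vec.
Qed.

Definition tensor_action := AlgAction tensor_act1 tensor_actM.
Definition sym_action := AlgAction sym_act1 sym_actM.

Local Notation tdeg := (@fdeg 'I_(\dim {:V})).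
Local Notation sdeg := (@mdeg 'I_(\dim {:V})).

Lemma tensor_vec_deg v : tensor_vec v \in deg_in tdeg (pred1 1%N).
Proof.
by rewrite rpred_sum // => i _; rewrite rpredZ // deg_inU //= fdegU.
Qed.
Lemma sym_vec_deg v : sym_vec v \in deg_in sdeg (pred1 1%N).
Proof.
by rewrite rpred_sum // => i _; rewrite rpredZ // deg_inU //= mdegU.
Qed.

Lemma deg_inS (M : monomType) (mf : measure M) (D E : pred nat) (x : {malg k[M]}) :
  (forall n, D n -> E n) -> x \in deg_in mf D -> x \in deg_in mf E.
Proof. by move=> DE /deg_inP Dx; apply/deg_inP => m /Dx/DE. Qed.

Lemma tensor_act_deg g (D : pred nat) x :
  x \in deg_in tdeg D -> tensor_act g x \in deg_in tdeg D.
Proof.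
apply: malg_lift_deg => -[m] Dm.
apply: (deg_inS (D := pred1 (size m))) => [n /eqP->//|{Dm}].
rewrite /= /tensor_word /=.
elim: m => [|i m IHm] /=; first by rewrite big_nil deg_in1.
rewrite big_cons; apply: deg_inM (tensor_vec_deg _) IHm.
by move=> ? ? /eqP-> /eqP->; apply/eqP.
Qed.

Lemma sym_act_deg g (D : pred nat) x :
  x \in deg_in sdeg D -> sym_act g x \in deg_in sdeg D.
Proof.
apply: malg_lift_deg => m Dm.
apply: (deg_inS (D := pred1 (mdeg m))) => [n /eqP->//|{Dm}].
rewrite mdeg_sum /= /sym_word /=; elim/big_rec2: _ => [|i a y _ hy]; first by rewrite deg_in1.
apply: (deg_inM (D := pred1 (m i)) (E := pred1 a)) hy; first by move=> ? ? /eqP-> /eqP->; apply/eqP.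
elim: (m i) => [|b IHb]; first by rewrite deg_in1.
rewrite exprS; apply: deg_inM (sym_vec_deg _) IHb.
by move=> ? ? /eqP-> /eqP->; apply/eqP.
Qed.

End InducedActions.

Section PBW.
Variables (k : fieldType) (G : finGroupType) (V : vectType k) (rho : linAction G V).

Local Notation TG := (skewAlg (tensor_action rho)).
Local Notation SG := (skewAlg (sym_action rho)).

Definition sym_deg (n : nat) : {pred symAlg V} :=
  deg_in (@mdeg 'I_(\dim {:V})) (pred1 n).
HB.instance Definition _ n :=
  GRing.isSubmodClosed.Build k (symAlg V) (sym_deg n)
    (deg_in_submod k (@mdeg 'I_(\dim {:V})) _).

Definition tensor_lt (n : nat) : {pred tensorAlg V} :=
  deg_in (@fdeg 'I_(\dim {:V})) (fun d => d < n)%N.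
HB.instance Definition _ n :=
  GRing.isSubmodClosed.Build k (tensorAlg V) (tensor_lt n)
    (deg_in_submod k (@fdeg 'I_(\dim {:V})) _).

Definition skew_sym_deg (n : nat) : {pred SG} := skew_pred (sym_deg n).
HB.instance Definition _ n := GRing.SubmodClosed.on (skew_sym_deg n).

Fact skew_sym_deg1 : 1 \in skew_sym_deg 0.
Proof.
apply/skew_predP => g; rewrite ffunE.
by case: ifP => _; [apply: deg_in1 | rewrite rpred0].
Qed.

Fact skew_sym_degM i j x y :
  x \in skew_sym_deg i -> y \in skew_sym_deg j -> x * y \in skew_sym_deg (i + j).
Proof.
apply: skew_predM => [a b|g a]; last exact: sym_act_deg.
by apply: deg_inM => ? ? /eqP-> /eqP->; apply/eqP.
Qed.

Definition skew_sym_graded : gradedAlg k :=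
  @GradedAlg k (fun n => subsp (skew_sym_deg n))
    (Sub 1 skew_sym_deg1)
    (fun i j x y => Sub (\val x * \val y) (skew_sym_degM (valP x) (valP y))).

Definition skew_tensor_lt (n : nat) : {pred TG} := skew_pred (tensor_lt n).
HB.instance Definition _ n := GRing.SubmodClosed.on (skew_tensor_lt n).

Let skew_tensor_ltM m n p x y :
    (forall i j, i < m -> j < n -> i + j < p)%N ->
  x \in skew_tensor_lt m -> y \in skew_tensor_lt n -> x * y \in skew_tensor_lt p.
Proof.
move=> mnp; apply: skew_predM => [a b|g a]; last exact: tensor_act_deg.
exact: deg_inM.
Qed.

Fact skew_tensor_fil1 : 1 \in skew_tensor_lt 1.
Proof.
apply/skew_predP => g; rewrite ffunE.
by case: ifP => _; [apply: deg_in1 | rewrite rpred0].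
Qed.
Fact skew_tensor_filS n x : x \in skew_tensor_lt n -> x \in skew_tensor_lt n.+1.
Proof.
move=> /skew_predP Fx; apply/skew_predP => g; apply: deg_inS (Fx g) => d.
exact: leqW.
Qed.
Fact skew_tensor_filM m n x y :
  x \in skew_tensor_lt m.+1 -> y \in skew_tensor_lt n.+1 ->
  x * y \in skew_tensor_lt (m + n).+1.
Proof. by apply: skew_tensor_ltM => i j; rewrite !ltnS; apply: leq_add. Qed.
Fact skew_tensor_filMl m n x y :
  x \in skew_tensor_lt m -> y \in skew_tensor_lt n.+1 ->
  x * y \in skew_tensor_lt (m + n).
Proof.
apply: skew_tensor_ltM => i j im; rewrite ltnS => jn.
by rewrite -addSn leq_add.
Qed.
Fact skew_tensor_filMr m n x y :
  x \in skew_tensor_lt m.+1 -> y \in skew_tensor_lt n ->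
  x * y \in skew_tensor_lt (m + n).
Proof.
by apply: skew_tensor_ltM => i j; rewrite ltnS => im jn; rewrite -addnS leq_add.
Qed.

Definition skew_tensor_filtration : filtration TG :=
  @Filtration k TG (fun n => skew_tensor_lt n)
    skew_tensor_fil1 skew_tensor_filS skew_tensor_filM
    skew_tensor_filMl skew_tensor_filMr.

Definition skew_vec (v : V) : TG := skew_tens _ (tensor_vec v) 1%g.
Definition skew_grp (g : G) : TG := skew_tens _ 1 g.

Lemma skew_grp_vec g v :
  skew_grp g * skew_vec v = skew_vec (rho g v) * skew_grp g.
Proof.
transitivity (skew_tens (tensor_action rho) (tensor_vec (rho g v)) g).
  by rewrite [LHS]skew_mul_tens mul1r mulg1; congr skew_tens; apply: tensor_act_vec.
by rewrite [RHS]skew_mul_tens rmorph1 mulr1 mul1g.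
Qed.

Definition kappa_rel (kappa : V -> V -> TG) (r : TG) : Prop :=
  exists v w, r = skew_vec v * skew_vec w - skew_vec w * skew_vec v - kappa v w.

(* kappa is meant to take values in (k (+) V) (x) kG, the span of the            *)
(* tensors 1 (x) g and v (x) g inside T(V) # G.                                 *)
Definition PBW_condition (kappa : V -> V -> TG) : Prop :=
  graded_isomorphic
    (assoc_graded (kappa_rel kappa) skew_tensor_filtration) skew_sym_graded.

End PBW.
Arguments PBW_condition {k G V} rho kappa.

(* Linear maps from the exterior square of U to W, as bilinear maps vanishing   *)
(* on the diagonal.                                                             *)
Record altMap (k : fieldType) (U W : lmodType k) := AltMap {
  alt_fun :> {bilinear U -> U -> W};
  alt_diag : forall u, alt_fun u u = 0
}.

Section LieOrbifold.
Variables (k : fieldType) (G : finGroupType) (V : vectType k) (rho : linAction G V).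
Implicit Types (br : altMap V V) (a : G -> altMap V k^o).

Definition is_lie_bracket (br : {bilinear V -> V -> V}) : Prop :=
  (forall x, br x x = 0) /\
  (forall x y z, br x (br y z) + br y (br z x) + br z (br x y) = 0).

(* Each rho g is bijective, so it is a Lie automorphism as soon as it preserves *)
(* the bracket.                                                                 *)
Definition acts_by_lie_automorphisms br : Prop :=
  forall g v w, rho g (br v w) = br (rho g v) (rho g w).

Definition drinfeld_hecke_algebra a : Prop :=
  PBW_condition rho (fun v w => \sum_(g : G) a g v w *: skew_grp rho g).

Definition lie_orbifold_algebra br a : Prop :=
  PBW_condition rho
    (fun v w => skew_vec rho (br v w) + \sum_(g : G) a g v w *: skew_grp rho g).

End LieOrbifold.

(* Main.v *)
Require Import Defs.
From HB Require Import structures.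
From mathcomp Require Import fingroup all_boot all_order all_algebra.
From mathcomp Require Import boolp.
From mathcomp Require Import finmap monalg.

Set Implicit Arguments.
Unset Strict Implicit.
Unset Printing Implicit Defensive.

Import GRing.Theory.
Local Open Scope ring_scope.

(** The defining relation of the quotient is r(v, w) = v w - w v - kappa(v, w)
    with kappa(v, w) = [v, w] + sum_g a_g(v, w) g.  The proof passes through a
    list of equations on the bracket and the forms ([pbw_equations]): the
    bracket and the forms are G-equivariant, the bracket satisfies the Jacobi
    identity, sum_cyc a_g(x, [y, z]) = 0, and sum_cyc a_g(y, z) (x - g x) = 0.
    The quotient has the PBW property if and only if they hold
    ([pbw_conditionP]).  Applied to the given bracket and to the zero bracket,
    this gives the theorem: for the zero bracket the list reduces to
    equivariance of the forms and to the last equation, so being a Drinfeld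
    Hecke algebra accounts for exactly these two, and the remaining equations
    say that V is a Lie algebra on which G acts by automorphisms and that its
    bracket is compatible with the forms.

    Necessity.  Two families of elements of the ideal I have degree at most 1:
    g kappa(v, w) g^-1 - kappa(g v, g w), and the cyclic sum of
    x kappa(y, z) - kappa(y, z) x reduced by relations
    ([pbw_equations_necessary]).  Their coefficients on the tensors g and v g
    are exactly the equations.  So it is enough that I has no nonzero element
    of degree at most 1.  The PBW property only provides some abstract
    isomorphism of graded algebras, but in degrees 0 and 1 the canonical
    surjection from S(V) # G onto the associated graded algebra goes between
    finite-dimensional spaces of equal dimension, hence it is injective
    ([assoc_graded_inj], [pbw_separated]).

    Sufficiency.  Let J_n ([relspan]) be spanned by the multiples
    u r(v_i, v_j) u' g, with u and u' words in the basis, of formal degree less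
    than n.  The point is that an element of I of degree less than n lies in
    J_n: then its top part vanishes in S(V) # G, since the top part of every
    relation is a commutator.  Sorting a word s by insertion and applying a
    relation at each exchange writes s, modulo the ideal, as the sorted word
    plus a correction of smaller degree ([sort_corr]).  Replacing the words of
    length n in an element of J_(n+1) by their corrections gives an element of
    J_n ([relspan_lower_top]); an element of degree less than n contains no such
    words, so if it lies in J_(n+1) then it lies in J_n.  What has to be checked
    is that the correction of a word i j t does not depend, modulo J_n, on
    whether i and j are exchanged first: this is the diamond property, where
    three letters meet, and it comes down to the equations above
    ([relspan_diamond], [relspan_jacobi]).  The symbol map from the associated
    graded algebra to S(V) # G is then well defined, and choosing a word for
    each monomial gives its inverse ([pbw_sufficient]).

    Everything up to the description of I in each degree is carried out in an
    arbitrary algebra containing compatible images of V and G, and only then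
    specialized to T(V) # G. *)

(** * Additive identities by reflection *)

(** Formal integer combinations of atoms.  After distributing products, an
    identity in a noncommutative ring is an identity in its additive group
    whose atoms are the noncommutative monomials; it holds as soon as every
    atom has the same integer coefficient on both sides. *)
Inductive zexpr := ZVar of nat | ZAdd of zexpr & zexpr | ZOpp of zexpr | ZNull.

Fixpoint zcoef (e : zexpr) (i : nat) : int :=
  match e with
  | ZVar j => (i == j)%:R
  | ZAdd e1 e2 => zcoef e1 i + zcoef e2 i
  | ZOpp e1 => - zcoef e1 i
  | ZNull => 0
  end.

Section Zeval.
Variables (U : zmodType) (env : seq U).

Fixpoint zeval (e : zexpr) : U :=
  match e with
  | ZVar j => env`_j
  | ZAdd e1 e2 => zeval e1 + zeval e2
  | ZOpp e1 => - zeval e1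
  | ZNull => 0
  end.

Lemma zeval_coef e : zeval e = \sum_(i < size env) env`_i *~ zcoef e i.
Proof.
elim: e => [j|e1 IH1 e2 IH2|e IH|] /=.
- have [ltj|lej] := ltnP j (size env); last first.
    rewrite nth_default // big1 // => i _.
    by rewrite (ltn_eqF (leq_trans (ltn_ord i) lej)).
  rewrite (bigD1 (Ordinal ltj)) //= eqxx mulr1z big1 ?addr0 // => i ij.
  by rewrite -val_eqE /= in ij; rewrite (negPf ij).
- by rewrite IH1 IH2 -big_split; apply: eq_bigr => i _; rewrite mulrzDr.
- by rewrite IH -sumrN; apply: eq_bigr => i _; rewrite mulrNz.
by rewrite big1 // => i _; rewrite mulr0z.
Qed.

Lemma zeval_eq e1 e2 :
  all (fun i => zcoef e1 i == zcoef e2 i) (iota 0 (size env)) ->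
  zeval e1 = zeval e2.
Proof.
move=> /allP h; rewrite !zeval_coef; apply: eq_bigr => i _.
by rewrite (eqP (h i _)) // mem_iota ltn_ord.
Qed.
End Zeval.

(** Atoms are compared up to unification and not syntactically, because the same
    ring operation may be presented through different structure instances. *)
Ltac zindex env x :=
  match env with
  | ?y :: _ => let _ := match constr:(tt) with _ => unify x y end in constr:(0%N)
  | _ :: ?env' => let n := zindex env' x in constr:(S n)
  end.
Ltac zatoms env e :=
  lazymatch e with
  | (?x + ?y)%R => let env' := zatoms env x in zatoms env' y
  | (- ?x)%R => zatoms env x
  | 0%R => env
  | _ => match constr:(tt) with
         | _ => let n := zindex env e in env
         | _ => constr:(e :: env)
         end
  end.
Ltac zreify env e :=
  lazymatch e with
  | (?x + ?y)%R =>
    let x' := zreify env x in let y' := zreify env y in constr:(ZAdd x' y')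
  | (- ?x)%R => let x' := zreify env x in constr:(ZOpp x')
  | 0%R => constr:(ZNull)
  | _ => let n := zindex env e in constr:(ZVar n)
  end.
Ltac zmodule :=
  cbv beta;
  lazymatch goal with
  | |- @eq ?U ?x ?y =>
    let env := zatoms constr:(@nil U) x in
    let env := zatoms env y in
    let ex := zreify env x in let ey := zreify env y in
    exact: (@zeval_eq _ env ex ey isT)
  end.
Ltac noncomm_ring :=
  cbv beta;
  rewrite ?(mulrDl, mulrDr, mulrBl, mulrBr, mulrN, mulNr, mulrA);
  rewrite ?(mulr1, mul1r, mulr0, mul0r);
  zmodule.

(** * Insertion sort of words *)

Section InsertionSort.
Variable n : nat.
Local Notation I := 'I_n.
Local Notation word := (seq I).

Fixpoint insert (i : I) (s : word) : word :=
  if s is j :: s' then if (i <= j)%N then i :: s else j :: insert i s' else [:: i].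

Fixpoint isort s := if s is i :: s' then insert i (isort s') else [::].

Lemma size_insert i s : size (insert i s) = (size s).+1.
Proof. by elim: s => //= j s IHs; case: ifP => //= _; rewrite IHs. Qed.
Lemma size_isort s : size (isort s) = size s.
Proof. by elim: s => //= i s IHs; rewrite size_insert IHs. Qed.

(** This holds for every word, sorted or not: both sides walk through the
    letters smaller than min(i, j) in the same way, and then place i and j in
    increasing order. *)
Lemma insertC i j s : insert i (insert j s) = insert j (insert i s).
Proof.
wlog ji : i j / (j < i)%N => [hw|].
  by case: (ltngtP i j) => [ij|ji|/val_inj->//]; [symmetry|]; apply: hw.
have ij : (i <= j)%N = false by rewrite leqNgt ji.
elim: s => [|l s IHs] /=; first by rewrite ij (ltnW ji).
have [jl|lj] := leqP j l; last first.
  have li := ltn_trans lj ji; rewrite /= leqNgt li /= IHs.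
  have [il|_] := leqP i l; first by rewrite ltnNge il in li.
  by rewrite /= leqNgt lj.
by rewrite /= ij; case: ifP => /= _; rewrite ?(ltnW ji) ?jl.
Qed.

Lemma isort_rem i s : i \in s -> isort s = insert i (isort (rem i s)).
Proof.
elim: s => //= j s IHs; rewrite inE eq_sym; case: eqVneq => [->|_] //= /IHs->.
exact: insertC.
Qed.

Lemma perm_isort s s' : perm_eq s s' -> isort s = isort s'.
Proof.
elim: s s' => [|i s IHs] s' ss'; first by move: ss'; rewrite perm_sym => /perm_nilP->.
have is' : i \in s' by rewrite -(perm_mem ss') mem_head.
rewrite (isort_rem is') -(IHs (rem i s')) // -(perm_cons i).
by rewrite (perm_trans ss') // perm_to_rem.
Qed.

End InsertionSort.

(** * Algebras generated by covariant copies of V and G *)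

(** What T(V) # G has in common with its quotients: images of V and of G that
    multiply as in a skew group algebra.  Working over an abstract such algebra
    keeps the noncommutative computations away from the concrete model of
    T(V) # G. *)
Record covariant (k : fieldType) (G : finGroupType) (V : vectType k)
    (rho : linAction G V) (T : algType k) := Covariant {
  vec : {linear V -> T};
  grp : G -> T;
  grp1 : grp 1%g = 1;
  grpM : forall g h, grp (g * h)%g = grp g * grp h;
  grp_vec : forall g v, grp g * vec v = vec (rho g v) * grp g
}.

Section Reduction.
Variables (k : fieldType) (G : finGroupType) (V : vectType k) (rho : linAction G V).
Variables (T : algType k) (C : covariant rho T).
Variables (br : altMap V V) (a : G -> altMap V k^o).

Local Notation vec := (vec C).
Local Notation grp := (grp C).
Local Notation grp1 := (grp1 C).
Local Notation grpM := (grpM C).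
Local Notation grp_vec := (grp_vec C).
Local Notation I := 'I_(\dim {:V}).
Local Notation word := (seq I).

Definition kappa v w := vec (br v w) + \sum_g a g v w *: grp g.
Definition comm_rel v w := vec v * vec w - vec w * vec v - kappa v w.
Definition letter (i : I) := vec (vbasis {:V})`_i.
Definition word_val (s : word) := \prod_(i <- s) letter i.
Definition mon s g := word_val s * grp g.
Definition kappa_basis (i j : I) := kappa (vbasis {:V})`_i (vbasis {:V})`_j.

Inductive deg_lt (n : nat) : T -> Prop :=
| deg_lt0 : deg_lt n 0
| deg_ltD x y : deg_lt n x -> deg_lt n y -> deg_lt n (x + y)
| deg_ltZ c x : deg_lt n x -> deg_lt n (c *: x)
| deg_lt_mon s g : (size s < n)%N -> deg_lt n (mon s g).

(** The filtered pieces J_n of the ideal.  The index bounds the formal degree of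
    the multiples of the relations that are used, and not only the degree of the
    resulting element: the comparison of the two is [relspan_deg_lt].  Multiples
    are built from the left, letter by letter, as words are, and group elements
    appear on the far right only; closure under multiplication by them on the
    left will follow from equivariance. *)
Inductive relspan : nat -> T -> Prop :=
| relspan0 n : relspan n 0
| relspanD n x y : relspan n x -> relspan n y -> relspan n (x + y)
| relspanZ n c x : relspan n x -> relspan n (c *: x)
| relspan_rel n (i j : I) s g : (size s + 2 < n)%N ->
    relspan n (comm_rel (vbasis {:V})`_i (vbasis {:V})`_j * mon s g)
| relspan_letter n i x : relspan n x -> relspan n.+1 (letter i * x).

Lemma kappaDl v v' w : kappa (v + v') w = kappa v w + kappa v' w.
Proof.
rewrite /kappa linearDl linearD addrACA; congr (_ + _).
by rewrite -big_split; apply: eq_bigr => g _; rewrite linearDl scalerDl.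
Qed.
Lemma kappaDr v w w' : kappa v (w + w') = kappa v w + kappa v w'.
Proof.
rewrite /kappa linearDr linearD addrACA; congr (_ + _).
by rewrite -big_split; apply: eq_bigr => g _; rewrite linearDr scalerDl.
Qed.
Lemma kappaZl c v w : kappa (c *: v) w = c *: kappa v w.
Proof.
rewrite /kappa linearZl_LR linearZ scalerDr scaler_sumr; congr (_ + _).
by apply: eq_bigr => g _; rewrite linearZl_LR /= scalerA.
Qed.
Lemma kappaZr c v w : kappa v (c *: w) = c *: kappa v w.
Proof.
rewrite /kappa linearZr_LR linearZ scalerDr scaler_sumr; congr (_ + _).
by apply: eq_bigr => g _; rewrite linearZr_LR /= scalerA.
Qed.
Lemma kappavv v : kappa v v = 0.
Proof.
rewrite /kappa alt_diag linear0 add0r big1 // => g _.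
by rewrite alt_diag scale0r.
Qed.
Lemma kappaC v w : kappa v w = - kappa w v.
Proof.
apply/eqP; rewrite -addr_eq0; apply/eqP.
by move: (kappavv (v + w)); rewrite kappaDl !kappaDr !kappavv add0r addr0.
Qed.

Lemma word_val_cons i s : word_val (i :: s) = letter i * word_val s.
Proof. exact: big_cons. Qed.
Lemma mon_cons i s g : mon (i :: s) g = letter i * mon s g.
Proof. by rewrite /mon word_val_cons mulrA. Qed.
Lemma mon1 s : mon s 1%g = word_val s.
Proof. by rewrite /mon grp1 mulr1. Qed.
Lemma mon_nil g : mon [::] g = grp g.
Proof. by rewrite /mon /word_val big_nil mul1r. Qed.

Lemma vec_sum v : vec v = \sum_i coord (vbasis {:V}) i v *: letter i.
Proof.
by rewrite [in LHS](basis_sum v) linear_sum; apply: eq_bigr => i _; rewrite linearZ.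
Qed.

Lemma comm_rel_mon (i j : I) s g :
  comm_rel (vbasis {:V})`_i (vbasis {:V})`_j * mon s g =
  mon (i :: j :: s) g - mon (j :: i :: s) g - kappa_basis i j * mon s g.
Proof. by rewrite /comm_rel !mulrBl -!mulrA !mon_cons. Qed.

Section SumClosure.
Variable P : T -> Prop.
Hypotheses (P0 : P 0) (PD : forall x y, P x -> P y -> P (x + y)).

Lemma span_sum (K : Type) (r : seq K) (Q : pred K) (F : K -> T) :
  (forall i, Q i -> P (F i)) -> P (\sum_(i <- r | Q i) F i).
Proof. by move=> PF; elim/big_rec: _ => // i x Qi Px; apply: PD => //; apply: PF. Qed.

End SumClosure.

Definition deg_lt_sum n := @span_sum _ (deg_lt0 n) (@deg_ltD n).
Definition relspan_sum n := @span_sum _ (relspan0 n) (@relspanD n).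

Lemma deg_ltW m n x : (m <= n)%N -> deg_lt m x -> deg_lt n x.
Proof.
move=> mn; elim=> [|? ? _ ? _ ?|? ? _ ?|s g sm].
- exact: deg_lt0.
- exact: deg_ltD.
- exact: deg_ltZ.
exact/deg_lt_mon/(leq_trans sm).
Qed.

Lemma relspanB n x y : relspan n x -> relspan n y -> relspan n (x - y).
Proof. by move=> Jx Jy; apply: relspanD => //; rewrite -scaleN1r; apply: relspanZ. Qed.

Lemma deg_ltB n x y : deg_lt n x -> deg_lt n y -> deg_lt n (x - y).
Proof. by move=> Jx Jy; apply: deg_ltD => //; rewrite -scaleN1r; apply: deg_ltZ. Qed.

Lemma deg_lt_letter n i x : deg_lt n x -> deg_lt n.+1 (letter i * x).
Proof.
elim=> [|y z _ ? _ ?|c y _ ?|s g sn].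
- by rewrite mulr0; apply: deg_lt0.
- by rewrite mulrDr; apply: deg_ltD.
- by rewrite -scalerAr; apply: deg_ltZ.
by rewrite -mon_cons; apply: deg_lt_mon.
Qed.

Lemma deg_lt_vec n v x : deg_lt n x -> deg_lt n.+1 (vec v * x).
Proof.
move=> nx; rewrite vec_sum mulr_suml; apply: deg_lt_sum => i _.
by rewrite -scalerAl; apply/deg_ltZ/deg_lt_letter.
Qed.

(** Moving g to the right through a word replaces each letter v_i by g v_i,
    which is a combination of letters, so the length does not change. *)
Lemma deg_lt_grp n g x : deg_lt n x -> deg_lt n (grp g * x).
Proof.
elim=> [|y z _ ? _ ?|c y _ ?|s h sn].
- by rewrite mulr0; apply: deg_lt0.
- by rewrite mulrDr; apply: deg_ltD.
- by rewrite -scalerAr; apply: deg_ltZ.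
elim: s n sn => [|i s IHs] n sn.
  by rewrite mon_nil -grpM -mon_nil; apply: deg_lt_mon.
rewrite mon_cons mulrA grp_vec -mulrA; case: n sn => // n sn.
by apply/deg_lt_vec/IHs.
Qed.

Lemma deg_ltM m n x y : deg_lt m.+1 x -> deg_lt n y -> deg_lt (m + n) (x * y).
Proof.
move=> mx ny; elim: mx => [|z t _ ? _ ?|c z _ ?|s h].
- by rewrite mul0r; apply: deg_lt0.
- by rewrite mulrDl; apply: deg_ltD.
- by rewrite -scalerAl; apply: deg_ltZ.
rewrite ltnS => sm; apply: deg_ltW (_ : deg_lt (size s + n) _); first by rewrite leq_add2r.
elim: s {sm} => [|i s IHs]; first by rewrite mon_nil; apply: deg_lt_grp.
by rewrite mon_cons -mulrA; apply: deg_lt_letter.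
Qed.

Lemma deg_lt_kappa n v w x : deg_lt n x -> deg_lt n.+1 (kappa v w * x).
Proof.
move=> nx; rewrite mulrDl; apply: deg_ltD; first exact: deg_lt_vec.
rewrite mulr_suml; apply: deg_lt_sum => g _; rewrite -scalerAl; apply: deg_ltZ.
by apply: deg_lt_grp; apply: deg_ltW nx.
Qed.

Lemma relspanW m n x : (m <= n)%N -> relspan m x -> relspan n x.
Proof.
move=> mn mx; elim: mx n mn => {m x} m.
- by move=> *; apply: relspan0.
- by move=> x y _ IHx _ IHy n mn; apply: relspanD; auto.
- by move=> c x _ IHx n mn; apply: relspanZ; auto.
- by move=> i j s g sm n mn; apply/relspan_rel/(leq_trans sm).
by move=> i x _ IHx [|n] // mn; apply/relspan_letter/IHx.
Qed.

Lemma comm_relDl u v w : comm_rel (u + v) w = comm_rel u w + comm_rel v w.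
Proof. rewrite /comm_rel kappaDl linearD; noncomm_ring. Qed.
Lemma comm_relDr u v w : comm_rel u (v + w) = comm_rel u v + comm_rel u w.
Proof. rewrite /comm_rel kappaDr linearD; noncomm_ring. Qed.
Lemma comm_relZl c v w : comm_rel (c *: v) w = c *: comm_rel v w.
Proof. by rewrite /comm_rel kappaZl linearZ -scalerAl -scalerAr -!scalerBr. Qed.
Lemma comm_relZr c v w : comm_rel v (c *: w) = c *: comm_rel v w.
Proof. by rewrite /comm_rel kappaZr linearZ -scalerAl -scalerAr -!scalerBr. Qed.

Lemma relspan_relM n v w x : deg_lt n x -> relspan n.+2 (comm_rel v w * x).
Proof.
elim=> [|y z _ ? _ ?|c y _ ?|s g sn].
- by rewrite mulr0; apply: relspan0.
- by rewrite mulrDr; apply: relspanD.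
- by rewrite -scalerAr; apply: relspanZ.
rewrite (basis_sum v) (basis_sum w).
have rel0l u : comm_rel 0 u = 0 by rewrite -(scale0r 0) comm_relZl scale0r.
have rel0r u : comm_rel u 0 = 0 by rewrite -(scale0r 0) comm_relZr scale0r.
rewrite (big_morph (comm_rel^~ _) (fun u v => comm_relDl u v _) (rel0l _)) mulr_suml.
apply: relspan_sum => i _; rewrite (big_morph (comm_rel _) (comm_relDr _) (rel0r _)) mulr_suml.
apply: relspan_sum => j _; rewrite comm_relZl comm_relZr -!scalerAl.
by do 2!apply: relspanZ; apply: relspan_rel; rewrite addn2 !ltnS.
Qed.

Lemma relspan_vec n v x : relspan n x -> relspan n.+1 (vec v * x).
Proof.
move=> nx; rewrite vec_sum mulr_suml; apply: relspan_sum => i _.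
by rewrite -scalerAl; apply/relspanZ/relspan_letter.
Qed.

Lemma relspan_deg n x : relspan n x -> deg_lt n x.
Proof.
elim=> {n x} n.
- exact: deg_lt0.
- by move=> ? ? _ ? _ ?; apply: deg_ltD.
- by move=> ? ? _ ?; apply: deg_ltZ.
- move=> i j s g; rewrite addn2 => sn; rewrite !mulrBl -!mulrA.
  have msg : deg_lt (size s).+1 (mon s g) by apply: deg_lt_mon.
  apply: deg_ltB; last exact: deg_ltW (ltnW sn) (deg_lt_kappa _ _ msg).
  by apply: deg_ltB; apply: (deg_ltW sn); do 2!apply: deg_lt_vec.
by move=> i x _ nx; apply: deg_lt_letter.
Qed.

Lemma deg_lt_eq0 x : deg_lt 0 x -> x = 0.
Proof. by elim=> [|y z _ -> _ ->|c y _ ->|//]; rewrite ?addr0 ?scaler0. Qed.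

Lemma relspan_eq0 x : relspan 0 x -> x = 0.
Proof. by move/relspan_deg/deg_lt_eq0. Qed.

(** Degree less than m + 1 times degree less than n is degree less than m + n:
    indices are strict bounds, hence the shift. *)
Lemma relspanMr m n x y : relspan m.+1 x -> deg_lt n y -> relspan (m + n) (x * y).
Proof.
move=> mx ny; move Em : m.+1 mx => m' mx; elim: mx m Em => {m' x} m'.
- by move=> m _; rewrite mul0r; apply: relspan0.
- by move=> x z _ IHx _ IHz m Em; rewrite mulrDl; apply: relspanD; auto.
- by move=> c x _ IHx m Em; rewrite -scalerAl; apply: relspanZ; auto.
- move=> i j s g; rewrite addn2 => sm m Em; rewrite -mulrA -{}Em in sm *.
  case: m sm => [|[|m]] //; rewrite !ltnS !addSn => sm.
  by apply: relspan_relM; apply: deg_ltM => //; apply: deg_lt_mon.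
move=> i x mx IHx m [Em]; rewrite -mulrA; case: m Em => [|m] Em.
  by rewrite -Em in mx; rewrite (relspan_eq0 mx) mul0r mulr0; apply: relspan0.
by rewrite addSn; apply/relspan_letter/IHx.
Qed.

(** * The obstructions of degree at most one *)

Definition cyclic_sum (W : zmodType) (f : V -> V -> V -> W) (x y z : V) :=
  f x y z + f y z x + f z x y.

Definition comm_kappa x y z := vec x * kappa y z - kappa y z * vec x.

(** The commutators [x, [y, z]] cancel in the cyclic sum by the Jacobi identity
    of the associative algebra, so replacing [y, z] by kappa(y, z) makes the
    cyclic sum an element of the ideal. *)
Lemma cyclic_comm_kappa x y z :
  cyclic_sum comm_kappa x y z =
  - cyclic_sum (fun x y z => vec x * comm_rel y z - comm_rel y z * vec x) x y z.
Proof. rewrite /cyclic_sum /comm_kappa /comm_rel; noncomm_ring. Qed.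

Definition defining_rel (r : T) := exists v w, r = comm_rel v w.

(** The vector coefficient of g in x kappa(y, z) - kappa(y, z) x: it comes from
    x g - g x = (x - g x) g. *)
Definition twist g x y z : V := a g y z *: (x - rho g x).

Lemma comm_kappaE x y z :
  comm_kappa x y z = comm_rel x (br y z) + vec (br x (br y z)) +
    (\sum_g a g x (br y z) *: grp g + \sum_g vec (twist g x y z) * grp g).
Proof.
rewrite /comm_kappa {1 2}/kappa mulrDr mulrDl mulr_sumr mulr_suml.
have -> : \sum_g vec (twist g x y z) * grp g =
   \sum_g vec x * (a g y z *: grp g) - \sum_g a g y z *: grp g * vec x.
  rewrite -sumrB; apply: eq_bigr => g _.
  by rewrite -scalerAr -scalerAl grp_vec -scalerBr -mulrBl -linearB scalerAl -linearZ.
rewrite /comm_rel /kappa; noncomm_ring.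
Qed.

Lemma cyclic_comm_kappaE x y z :
  cyclic_sum comm_kappa x y z = cyclic_sum (fun x y z => comm_rel x (br y z)) x y z +
    vec (cyclic_sum (fun x y z => br x (br y z)) x y z) +
    (\sum_g cyclic_sum (fun x y z => a g x (br y z)) x y z *: grp g +
     \sum_g vec (cyclic_sum (twist g) x y z) * grp g).
Proof.
rewrite /cyclic_sum !comm_kappaE !linearD.
have -> : \sum_g (a g x (br y z) + a g y (br z x) + a g z (br x y)) *: grp g =
  \sum_g a g x (br y z) *: grp g + \sum_g a g y (br z x) *: grp g +
  \sum_g a g z (br x y) *: grp g.
  by rewrite -!big_split; apply: eq_bigr => g _; rewrite !scalerDl.
have -> : \sum_g vec (twist g x y z + twist g y z x + twist g z x y) * grp g =
  \sum_g vec (twist g x y z) * grp g + \sum_g vec (twist g y z x) * grp g +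
  \sum_g vec (twist g z x y) * grp g.
  by rewrite -!big_split; apply: eq_bigr => g _; rewrite !linearD !mulrDl.
zmodule.
Qed.

Lemma grp_kappa g v w :
  grp g * kappa v w * grp g^-1%g - kappa (rho g v) (rho g w) =
  vec (rho g (br v w) - br (rho g v) (rho g w)) +
  \sum_h (a (h ^ g)%g v w - a h (rho g v) (rho g w)) *: grp h.
Proof.
rewrite /kappa mulrDr mulrDl grp_vec -(mulrA (vec _)) -grpM mulgV grp1 mulr1.
rewrite linearB mulr_sumr mulr_suml.
have -> : \sum_h (a (h ^ g)%g v w - a h (rho g v) (rho g w)) *: grp h =
  \sum_h a (h ^ g)%g v w *: grp h - \sum_h a h (rho g v) (rho g w) *: grp h.
  by rewrite -sumrB; apply: eq_bigr => h _; apply: scalerBl.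
have -> : \sum_h a (h ^ g)%g v w *: grp h =
  \sum_i grp g * (a i v w *: grp i) * grp g^-1%g.
  rewrite (reindex_inj (@conjg_inj _ g^-1%g)) /=; apply: eq_bigr => h _.
  by rewrite conjgKV -scalerAr -scalerAl -!grpM conjgE invgK mulgA.
zmodule.
Qed.

(** The vanishing of all coefficients in [grp_kappa] and [cyclic_comm_kappaE].
    For the vector part at g = 1 the twist vanishes, which is why [br_jacobi]
    and [form_twist] can be separated. *)
Record pbw_equations : Prop := PBWEquations {
  br_equivariant : forall g v w, rho g (br v w) = br (rho g v) (rho g w);
  form_equivariant : forall g h v w, a (h ^ g)%g v w = a h (rho g v) (rho g w);
  br_jacobi : forall x y z, cyclic_sum (fun x y z => br x (br y z)) x y z = 0;
  form_jacobi : forall g x y z, cyclic_sum (fun x y z => a g x (br y z)) x y z = 0;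
  form_twist : forall g x y z, cyclic_sum (twist g) x y z = 0
}.

(** * Necessity of the equations *)

Definition grp_comb (c : {ffun G -> k^o}) : T := \sum_g c g *: grp g.
Fact grp_comb_linear : linear grp_comb.
Proof.
move=> t c c'; rewrite /grp_comb scaler_sumr -big_split; apply: eq_bigr => g _ /=.
by rewrite !ffunE scalerDl scalerA.
Qed.
HB.instance Definition _ :=
  GRing.isLinear.Build k {ffun G -> k^o} T _ grp_comb grp_comb_linear.

Definition vec_comb (w : {ffun G -> V}) : T := \sum_g vec (w g) * grp g.
Fact vec_comb_linear : linear vec_comb.
Proof.
move=> t w w'; rewrite /vec_comb scaler_sumr -big_split; apply: eq_bigr => g _ /=.
by rewrite !ffunE linearP mulrDl scalerAl.
Qed.
HB.instance Definition _ :=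
  GRing.isLinear.Build k {ffun G -> V} T _ vec_comb vec_comb_linear.

Lemma grp_combE (c : G -> k^o) : grp_comb [ffun g => c g] = \sum_g c g *: grp g.
Proof. by apply: eq_bigr => g _; rewrite ffunE. Qed.
Lemma vec_combE (w : G -> V) : vec_comb [ffun g => w g] = \sum_g vec (w g) * grp g.
Proof. by apply: eq_bigr => g _; rewrite ffunE. Qed.

Lemma vec_comb_delta v g : vec_comb [ffun h => if h == g then v else 0] = vec v * grp g.
Proof.
rewrite vec_combE (bigD1 g) //= eqxx big1 ?addr0 // => h /negPf->.
by rewrite linear0 mul0r.
Qed.

Lemma deg_lt_grp_comb c : deg_lt 1 (grp_comb c).
Proof.
by apply: deg_lt_sum => g _; apply: deg_ltZ; rewrite -mon_nil; apply: deg_lt_mon.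
Qed.
Lemma deg_lt_vec_comb w : deg_lt 2 (vec_comb w).
Proof.
by apply: deg_lt_sum => g _; apply: deg_lt_vec; rewrite -mon_nil; apply: deg_lt_mon.
Qed.

Lemma deg_lt1P x : deg_lt 1 x -> exists c, x = grp_comb c.
Proof.
elim=> [|y z _ [c ->] _ [c' ->]|t y _ [c ->]|[|//] g _].
- by exists 0; rewrite linear0.
- by exists (c + c'); rewrite linearD.
- by exists (t *: c); rewrite linearZ.
exists [ffun h => if h == g then 1 else 0].
rewrite grp_combE (bigD1 g) //= eqxx scale1r mon_nil big1 ?addr0 // => h /negPf->.
by rewrite scale0r.
Qed.

Lemma deg_lt2P x : deg_lt 2 x -> exists w, deg_lt 1 (x - vec_comb w).
Proof.
elim=> [|y z _ [c yc] _ [c' zc']|t y _ [c yc]|[|i [|//]] g _].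
- by exists 0; rewrite linear0 subr0; apply: deg_lt0.
- by exists (c + c'); rewrite linearD opprD addrACA; apply: deg_ltD.
- by exists (t *: c); rewrite linearZ -scalerBr; apply: deg_ltZ.
- by exists 0; rewrite linear0 subr0; apply: deg_lt_mon.
exists [ffun h => if h == g then (vbasis {:V})`_i else 0].
by rewrite vec_comb_delta mon_cons mon_nil subrr; apply: deg_lt0.
Qed.

Local Notation ideal := (ideal_gen defining_rel).

Lemma idealN x : ideal x -> ideal (- x).
Proof. by rewrite -mulN1r; apply: IdealMl. Qed.
Lemma idealB x y : ideal x -> ideal y -> ideal (x - y).
Proof. by move=> Ix /idealN; apply: IdealD. Qed.
Lemma ideal_comm_rel v w : ideal (comm_rel v w).
Proof. by apply: IdealGen; exists v, w. Qed.

Lemma ideal_grp_kappa g v w :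
  ideal (grp g * kappa v w * grp g^-1%g - kappa (rho g v) (rho g w)).
Proof.
have -> : grp g * kappa v w * grp g^-1%g - kappa (rho g v) (rho g w) =
    comm_rel (rho g v) (rho g w) - grp g * comm_rel v w * grp g^-1%g.
  have conj u u' : grp g * vec u * vec u' * grp g^-1%g = vec (rho g u) * vec (rho g u').
    rewrite grp_vec -(mulrA _ (grp g)) grp_vec -!mulrA -grpM mulgV grp1 mulr1 //.
  rewrite /comm_rel !mulrBr !mulrBl !mulrA !conj; zmodule.
apply: idealB; first exact: ideal_comm_rel.
by apply/IdealMr/IdealMl/ideal_comm_rel.
Qed.

Lemma ideal_cyclic_comm_kappa x y z : ideal (cyclic_sum comm_kappa x y z).
Proof.
rewrite cyclic_comm_kappa; apply: idealN.
have comm u v w : ideal (vec u * comm_rel v w - comm_rel v w * vec u).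
  by apply: idealB; [apply: IdealMl|apply: IdealMr]; apply: ideal_comm_rel.
by rewrite /cyclic_sum; apply: IdealD => //; apply: IdealD.
Qed.

(** The hypothesis says that the ideal meets the elements of degree at most 1,
    written in their basis of tensors v g and g, in zero only. *)
Lemma pbw_equations_necessary :
  (forall w c, ideal (vec_comb w + grp_comb c) -> w = 0 /\ c = 0) ->
  pbw_equations.
Proof.
move=> sep.
have equivar g v w : rho g (br v w) = br (rho g v) (rho g w) /\
    forall h, a (h ^ g)%g v w = a h (rho g v) (rho g w).
  have := ideal_grp_kappa g v w; rewrite grp_kappa.
  rewrite -[vec _]mulr1 -grp1 -vec_comb_delta -grp_combE => /sep[/ffunP v0 /ffunP c0].
  split=> [|h]; apply/subr0_eq.
    by have := v0 1%g; rewrite !ffunE eqxx.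
  by have := c0 h; rewrite !ffunE.
have jac x y z : cyclic_sum (fun x y z => br x (br y z)) x y z = 0 /\ forall g,
    cyclic_sum (fun x y z => a g x (br y z)) x y z = 0 /\ cyclic_sum (twist g) x y z = 0.
  set J := cyclic_sum _ x y z.
  have : ideal (
      vec_comb ([ffun h => if h == 1%g then J else 0]
                + [ffun g => cyclic_sum (twist g) x y z])
      + grp_comb [ffun g => cyclic_sum (fun x y z => a g x (br y z)) x y z]).
    rewrite linearD /= vec_comb_delta grp1 mulr1 vec_combE grp_combE.
    have -> : vec J + \sum_g vec (cyclic_sum (twist g) x y z) * grp g +
        \sum_g cyclic_sum (fun x y z => a g x (br y z)) x y z *: grp g =
      cyclic_sum comm_kappa x y z - cyclic_sum (fun x y z => comm_rel x (br y z)) x y z.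
      rewrite cyclic_comm_kappaE -/J; zmodule.
    apply: idealB; first exact: ideal_cyclic_comm_kappa.
    rewrite /cyclic_sum; apply: IdealD (ideal_comm_rel _ _).
    by apply: IdealD; apply: ideal_comm_rel.
  case/sep => /ffunP v0 /ffunP c0.
(* At g = 1 the vector coefficient is the sum of the Jacobi expression and of
     a twist, which vanishes because 1 acts as the identity. *)
  have twist1 : cyclic_sum (twist 1) x y z = 0.
    by rewrite /cyclic_sum /twist lact1 !id_lfunE !subrr !scaler0 !addr0.
  split=> [|g]; first by have := v0 1%g; rewrite !ffunE eqxx twist1 addr0.
  split; first by have := c0 g; rewrite !ffunE.
  have [->//|/negPf g1] := eqVneq g 1%g.
  by have := v0 g; rewrite !ffunE g1 add0r.
split=> [g v w|g h v w|x y z|g x y z|g x y z].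
- by case: (equivar g v w).
- by case: (equivar g v w).
- by case: (jac x y z).
- by case: (jac x y z) => _ /(_ g)[].
by case: (jac x y z) => _ /(_ g)[].
Qed.

(** * Corrections made by sorting a word *)

Hypothesis eqs : pbw_equations.

(** Equivariance of kappa, in the form that makes the ideal spanned by multiples
    of relations with group elements on one side only. *)
Lemma grp_comm_rel g v w : grp g * comm_rel v w = comm_rel (rho g v) (rho g w) * grp g.
Proof.
have ek : grp g * kappa v w = kappa (rho g v) (rho g w) * grp g.
  have := grp_kappa g v w; rewrite (br_equivariant eqs) subrr linear0 add0r.
  rewrite big1 => [/subr0_eq <-|h _]; last by rewrite (form_equivariant eqs) subrr scale0r.
  by rewrite -mulrA -grpM mulVg grp1 mulr1.
by rewrite /comm_rel !mulrBr ek !mulrA !grp_vec -!mulrA !grp_vec !mulrA -!mulrBl.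
Qed.

Lemma relspan_grp n g x : relspan n x -> relspan n (grp g * x).
Proof.
elim=> {n x} n.
- by rewrite mulr0; apply: relspan0.
- by move=> x y _ ? _ ?; rewrite mulrDr; apply: relspanD.
- by move=> c x _ ?; rewrite -scalerAr; apply: relspanZ.
- move=> i j s h; rewrite addn2 => sn; rewrite mulrA grp_comm_rel -mulrA.
  by apply/(relspanW sn)/relspan_relM/deg_lt_grp/deg_lt_mon.
by move=> i x _ ?; rewrite mulrA grp_vec -mulrA; apply: relspan_vec.
Qed.

Lemma relspan_kappa n v w x : relspan n x -> relspan n.+1 (kappa v w * x).
Proof.
move=> nx; rewrite mulrDl; apply: relspanD; first exact: relspan_vec.
rewrite mulr_suml; apply: relspan_sum => g _; rewrite -scalerAl; apply: relspanZ.
by apply/relspan_grp/relspanW/nx.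
Qed.

Lemma deg_lt1 : deg_lt 1 1.
Proof. by rewrite -grp1 -mon_nil; apply: deg_lt_mon. Qed.

(** The obstruction of the overlap of three letters.  By the equations, all that
    remains of it is a sum of three relations, of degree 2, whence the index. *)
Lemma relspan_jacobi x y z : relspan 3 (cyclic_sum comm_kappa x y z).
Proof.
rewrite cyclic_comm_kappaE (br_jacobi eqs) linear0 addr0.
rewrite big1 ?add0r => [|g _]; last by rewrite (form_jacobi eqs) scale0r.
rewrite big1 ?addr0 => [|g _]; last by rewrite (form_twist eqs) linear0 mul0r.
have rel3 u v : relspan 3 (comm_rel u v).
  by rewrite -[comm_rel u v]mulr1; apply/relspan_relM/deg_lt1.
by rewrite /cyclic_sum; apply: relspanD => //; apply: relspanD.
Qed.

(** Lower order terms produced when i travels to its place in s: each exchange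
    with a smaller letter j contributes kappa(v_i, v_j) at that position. *)
Fixpoint insert_corr (i : I) (s : word) : T :=
  if s is j :: s' then
    if (i <= j)%N then 0 else kappa_basis i j * word_val s' + letter j * insert_corr i s'
  else 0.

Fixpoint sort_corr s : T :=
  if s is i :: s' then letter i * sort_corr s' + insert_corr i (isort s') else 0.

Lemma deg_lt_word_val s : deg_lt (size s).+1 (word_val s).
Proof. by rewrite -mon1; apply: deg_lt_mon. Qed.

Lemma deg_lt_insert_corr i s : deg_lt (size s).+1 (insert_corr i s).
Proof.
elim: s => [|j s IHs] /=; first exact: deg_lt0.
case: ifP => _; first exact: deg_lt0.
by apply: deg_ltD; [apply/deg_lt_kappa/deg_lt_word_val|apply: deg_lt_letter].
Qed.

Lemma deg_lt_sort_corr s : deg_lt (size s) (sort_corr s).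
Proof.
elim: s => [|i s IHs] /=; first exact: deg_lt0.
apply: deg_ltD; first exact: deg_lt_letter.
by rewrite -(size_isort s); apply: deg_lt_insert_corr.
Qed.

Lemma insert_corrP i s :
  relspan (size s).+2 (letter i * word_val s - word_val (insert i s) - insert_corr i s).
Proof.
elim: s => [|j s IHs] /=.
  by rewrite word_val_cons subrr subr0; apply: relspan0.
case: ifP => _; first by rewrite !word_val_cons subrr subr0; apply: relspan0.
have -> : letter i * word_val (j :: s) - word_val (j :: insert i s)
    - (kappa_basis i j * word_val s + letter j * insert_corr i s)
  = comm_rel (vbasis {:V})`_i (vbasis {:V})`_j * word_val s +
    letter j * (letter i * word_val s - word_val (insert i s) - insert_corr i s).
  rewrite /comm_rel -/(kappa_basis i j) -/(letter i) -/(letter j) !word_val_cons.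
  noncomm_ring.
apply: relspanD; last exact: relspan_letter.
by apply: relspan_relM; apply: deg_lt_word_val.
Qed.

Lemma sort_corrP s : relspan (size s).+1 (word_val s - word_val (isort s) - sort_corr s).
Proof.
elim: s => [|i s IHs] /=; first by rewrite subrr subr0; apply: relspan0.
have -> : word_val (i :: s) - word_val (insert i (isort s))
    - (letter i * sort_corr s + insert_corr i (isort s))
  = letter i * (word_val s - word_val (isort s) - sort_corr s) +
    (letter i * word_val (isort s) - word_val (insert i (isort s))
     - insert_corr i (isort s)).
  rewrite !word_val_cons; noncomm_ring.
apply: relspanD; first exact: relspan_letter.
by rewrite -(size_isort s); apply: insert_corrP.
Qed.

(** Starting from i j s, inserting j and then i, or exchanging i and j first and
    then inserting i and then j, gives the same word; this is the difference of
    the accumulated corrections, including the one of the first exchange. *)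
Definition diamond i j s :=
  letter i * insert_corr j s + insert_corr i (insert j s)
  - (letter j * insert_corr i s + insert_corr j (insert i s))
  - kappa_basis i j * word_val s.

Lemma kappa_basisC i j : kappa_basis i j = - kappa_basis j i.
Proof. exact: kappaC. Qed.

Lemma diamondC i j s : diamond i j s = - diamond j i s.
Proof. rewrite /diamond (kappa_basisC i j); noncomm_ring. Qed.

(** Assume j < i and induct on s.  When j is at most the first letter l of s, one of the
    two paths makes the exchange of i and j that the other one starts with, and
    the two corrections are literally equal.  When l < j < i, all three pairs
    of letters are exchanged on both paths; comparing the two sides of this
    hexagon leaves the cyclic sum of commutators with kappa, and multiples of
    relations of the allowed degree. *)
Lemma relspan_diamond i j s : relspan (size s).+2 (diamond i j s).
Proof.
wlog ji : i j / (j < i)%N => [hw|].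
  case: (ltngtP i j) => [ij|ji|/val_inj->]; last 2 first.
  - exact: hw.
  - rewrite /diamond /kappa_basis kappavv mul0r subr0 subrr; exact: relspan0.
  by rewrite diamondC -scaleN1r; apply/relspanZ/hw.
have ij : (i <= j)%N = false by rewrite leqNgt ji.
elim: s => [|l s IHs].
  rewrite /diamond /= ij (ltnW ji).
  set t := kappa_basis i j * word_val [::].
  have -> : letter i * 0 + (t + letter j * 0) - (letter j * 0 + 0) - t = 0.
    noncomm_ring.
  exact: relspan0.
have [jl|lj] := leqP j l.
  have -> : diamond i j (l :: s) = 0; last exact: relspan0.
  rewrite /diamond /= jl /= ij.
  have -> : insert_corr j (if (i <= l)%N then [:: i, l & s] else l :: insert i s) = 0.
    by case: ifP => _ /=; rewrite ?(ltnW ji) ?jl.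
  rewrite /= -/(insert_corr i (l :: s)); set c := insert_corr i (l :: s); noncomm_ring.
have li := ltn_trans lj ji.
have jl : (j <= l)%N = false by rewrite leqNgt lj.
have il : (i <= l)%N = false by rewrite leqNgt li.
have -> : diamond i j (l :: s) =
  letter l * diamond i j s
  + (comm_rel (vbasis {:V})`_i (vbasis {:V})`_l * insert_corr j s
     - comm_rel (vbasis {:V})`_j (vbasis {:V})`_l * insert_corr i s)
  + (kappa_basis j l * (letter i * word_val s - word_val (insert i s) - insert_corr i s)
     - kappa_basis i l * (letter j * word_val s - word_val (insert j s) - insert_corr j s))
  + cyclic_sum comm_kappa (vbasis {:V})`_i (vbasis {:V})`_j (vbasis {:V})`_l * word_val s.
  rewrite /diamond /= jl il /= jl il /cyclic_sum /comm_kappa /comm_rel.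
  rewrite -!/(kappa_basis _ _) -!/(letter _) !word_val_cons (kappa_basisC l i).
  noncomm_ring.
apply: relspanD; last exact: relspanMr (relspan_jacobi _ _ _) (deg_lt_word_val s).
apply: relspanD.
  apply: relspanD; first exact: relspan_letter.
  by apply: relspanB; apply/relspan_relM/deg_lt_insert_corr.
by apply: relspanB; apply/relspan_kappa/insert_corrP.
Qed.

(** The diamond at the head of a word whose tail is not sorted: sorting the tail
    first changes the difference by multiples of relations only. *)
Lemma relspan_sort_corr_swap i j s :
  relspan (size s).+2
    (sort_corr (i :: j :: s) - sort_corr (j :: i :: s) - kappa_basis i j * word_val s).
Proof.
have -> : sort_corr (i :: j :: s) - sort_corr (j :: i :: s) - kappa_basis i j * word_val s =
   diamond i j (isort s) + comm_rel (vbasis {:V})`_i (vbasis {:V})`_j * sort_corr s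
   - kappa_basis i j * (word_val s - word_val (isort s) - sort_corr s).
  rewrite /diamond /comm_rel /= -/(kappa_basis _ _) -!/(letter _); noncomm_ring.
apply: relspanB; last by apply/relspan_kappa/sort_corrP.
apply: relspanD; last exact/relspan_relM/deg_lt_sort_corr.
by rewrite -(size_isort s); apply: relspan_diamond.
Qed.

Lemma relspan_grpr n x g : relspan n x -> relspan n (x * grp g).
Proof.
case: n => [/relspan_eq0->|n nx]; first by rewrite mul0r; apply: relspan0.
by rewrite -addn1; apply: relspanMr nx _; rewrite -mon_nil; apply: deg_lt_mon.
Qed.

Lemma relspan_sort_corr_swap_mon i j s g :
  relspan (size s).+2
    (sort_corr (i :: j :: s) * grp g - sort_corr (j :: i :: s) * grp g
     - kappa_basis i j * mon s g).
Proof.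
rewrite /mon mulrA -!mulrBl; apply: relspan_grpr; exact: relspan_sort_corr_swap.
Qed.

(** * The ideal in each degree *)

(** The products of words and group elements form a basis, through the universal
    property that is used: right kG-linear maps may be prescribed on words, and
    linear statements may be checked on basis elements. *)
Record mon_basis := MonBasis {
  lext : (word -> T) -> {linear T -> T};
  lext_mon : forall phi s g, lext phi (mon s g) = phi s * grp g;
  mon_ind : forall P : T -> Prop, P 0 ->
    (forall x y, P x -> P y -> P (x + y)) -> (forall c x, P x -> P (c *: x)) ->
    (forall s g, P (mon s g)) -> forall x, P x
}.
Variable B : mon_basis.

Lemma linear_ext (f f' : T -> T) :
  linear f -> linear f' -> (forall s g, f (mon s g) = f' (mon s g)) -> f =1 f'.
Proof.
move=> fL f'L fmon.
have lin0 (h : T -> T) : linear h -> h 0 = 0 :> T.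
  by move=> hL; have := hL (-1) 0 0; rewrite scaler0 addr0 scaleN1r addNr.
have f0 := lin0 f fL; have f'0 := lin0 f' f'L.
apply: (mon_ind B) => [|x y Ex Ey|c x Ex|//]; first by rewrite f0 f'0.
  by rewrite -[x]scale1r fL f'L Ex Ey.
by rewrite -[c *: x]addr0 fL f'L Ex f0 f'0.
Qed.

(** On an element of degree at most n: its part of degree n with words sorted,
    and the remainder of lower degree after sorting the part of degree n.  The
    element is the sum of these two modulo the ideal. *)
Definition sorted_top n : T -> T :=
  lext B (fun s => if size s == n then word_val (isort s) else 0).
HB.instance Definition _ n := GRing.Linear.on (sorted_top n).
Definition lower_top n : T -> T :=
  lext B (fun s => if size s == n then sort_corr s else word_val s).
HB.instance Definition _ n := GRing.Linear.on (lower_top n).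

Lemma sorted_topB n : {morph sorted_top n : x y / x - y}.
Proof. exact: linearB. Qed.
Lemma lower_topB n : {morph lower_top n : x y / x - y}.
Proof. exact: linearB. Qed.

Lemma sorted_top_mon n s g :
  sorted_top n (mon s g) = if size s == n then mon (isort s) g else 0.
Proof. by rewrite /sorted_top lext_mon; case: ifP; rewrite ?mul0r. Qed.
Lemma lower_top_mon n s g :
  lower_top n (mon s g) =
  if size s == n then sort_corr s * grp g else mon s g.
Proof. by rewrite /lower_top lext_mon; case: ifP. Qed.

Lemma sorted_top_lt n x : deg_lt n x -> sorted_top n x = 0.
Proof.
elim=> [|y z _ Ey _ Ez|c y _ Ey|s g sn]; first exact: linear0.
- by rewrite linearD /= Ey Ez addr0.
- by rewrite linearZ /= Ey scaler0.
by rewrite sorted_top_mon (ltn_eqF sn).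
Qed.

Lemma lower_top_lt n x : deg_lt n x -> lower_top n x = x.
Proof.
elim=> [|y z _ Ey _ Ez|c y _ Ey|s g sn]; first exact: linear0.
- by rewrite linearD /= Ey Ez.
- by rewrite linearZ /= Ey.
by rewrite lower_top_mon (ltn_eqF sn).
Qed.

Lemma sorted_top_letter n i x :
  sorted_top n.+1 (letter i * x) = lext B (fun s => word_val (insert i s)) (sorted_top n x).
Proof.
move: x; apply: linear_ext => [c x y|c x y|s g].
- by rewrite mulrDr -scalerAr [LHS]linearP.
- by rewrite [sorted_top n _]linearP [LHS]linearP.
rewrite -mon_cons [LHS]sorted_top_mon [sorted_top _ _]sorted_top_mon.
rewrite (_ : (size (i :: s) == n.+1) = (size s == n)) //.
case: (size s == n); last by symmetry; exact: linear0.
by rewrite lext_mon.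
Qed.

Lemma lower_top_letter n i x :
  lower_top n.+1 (letter i * x) =
  letter i * lower_top n x + lext B (insert_corr i) (sorted_top n x).
Proof.
move: x; apply: linear_ext => [c x y|c x y|s g].
- by rewrite mulrDr -scalerAr [LHS]linearP.
- rewrite [sorted_top n _]linearP [lower_top n _]linearP linearP.
  by rewrite mulrDr -scalerAr scalerDr addrACA.
rewrite -mon_cons [LHS]lower_top_mon [lower_top _ _]lower_top_mon sorted_top_mon.
rewrite (_ : (size (i :: s) == n.+1) = (size s == n)) //.
case: (size s == n); last by rewrite linear0 addr0 mon_cons.
by rewrite lext_mon [LHS]mulrDl -mulrA.
Qed.

(** The descent step.  Read as a rule on representatives: if x is a combination
    of multiples of relations of formal degree at most n, then its part of
    degree n sorts to zero, and what is left after sorting is a combination of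
    multiples of relations of degree less than n.  The first conclusion is
    needed for the induction on the leading letter, since inserting a letter
    corrects the sorted part. *)
Lemma relspan_lower_top n x :
  relspan n.+1 x -> sorted_top n x = 0 /\ relspan n (lower_top n x).
Proof.
move En : n.+1 => n' n'x; elim: n'x n En => {x} n'.
- by move=> n _; rewrite !linear0; split=> //; apply: relspan0.
- move=> x y _ IHx _ IHy n En; rewrite !linearD /=.
  have [-> Jx] := IHx n En; have [-> Jy] := IHy n En; rewrite addr0.
  by split=> //; apply: relspanD.
- move=> c x _ IHx n En; rewrite !linearZ /=.
  have [-> Jx] := IHx n En; rewrite scaler0.
  by split=> //; apply: relspanZ.
- move=> i j s g; rewrite addn2 => sn n En; rewrite -En ltnS in sn.
  set r := comm_rel (vbasis {:V})`_i (vbasis {:V})`_j.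
  have Jr m : (size s + 2 < m)%N -> relspan m (r * mon s g) by apply: relspan_rel.
  have := sn; rewrite leq_eqVlt => /predU1P[Es|]; last first.
    rewrite -addn2 => /Jr Jn; have nx := relspan_deg Jn.
    by rewrite sorted_top_lt // lower_top_lt.
  have kn : deg_lt n (kappa_basis i j * mon s g).
    by rewrite -Es; apply/deg_lt_kappa/deg_lt_mon.
  have -> : r * mon s g = _ := comm_rel_mon i j s g.
  rewrite !sorted_topB !lower_topB (sorted_top_lt kn) (lower_top_lt kn).
  have Eij l l' : size [:: l, l' & s] == n by rewrite -Es.
  rewrite (sorted_top_mon n (i :: _)) (sorted_top_mon n (j :: _)).
  rewrite (lower_top_mon n (i :: _)) (lower_top_mon n (j :: _)) !Eij.
  have -> : isort [:: i, j & s] = isort [:: j, i & s] by exact: insertC.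
  split; first by rewrite [X in X - _]subrr subr0.
  rewrite -Es; exact: relspan_sort_corr_swap_mon.
move=> i x Jx IHx n [En]; case: n En IHx => [|n] En IHx.
  rewrite -En in Jx; rewrite (relspan_eq0 Jx) mulr0 !linear0.
  by split=> //; apply: relspan0.
have [E Jn] := IHx n En.
rewrite sorted_top_letter lower_top_letter E !linear0 addr0.
by split=> //; apply: relspan_letter.
Qed.

(** If x already has degree less than m, then [lower_top] does nothing to it, so
    the descent step lowers the formal degree and keeps x. *)
Lemma relspan_deg_lt n m x : relspan m x -> deg_lt n x -> relspan n x.
Proof.
elim: m => [/relspan_eq0-> _|m IHm mx nx]; first exact: relspan0.
have [mn|nm] := leqP m.+1 n; first exact: relspanW mx.
apply: IHm => //; rewrite -[x](lower_top_lt (n := m)); last exact: deg_ltW nx.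
by case: (relspan_lower_top mx).
Qed.

Lemma exists_deg_lt x : exists n, deg_lt n x.
Proof.
move: x; apply: (mon_ind B) => [|x y [m mx] [n ny]|c x [n nx]|s g].
- by exists 0%N; apply: deg_lt0.
- exists (maxn m n); apply: deg_ltD; [apply: deg_ltW mx|apply: deg_ltW ny].
    exact: leq_maxl.
  exact: leq_maxr.
- by exists n; apply: deg_ltZ.
by exists (size s).+1; apply: deg_lt_mon.
Qed.

Lemma ideal_relspan x :
  ideal_gen defining_rel x -> exists n, relspan n x.
Proof.
elim=> {x} [_ [v [w ->]]||x y _ [m mx] _ [n ny]|y x _ [n nx]|y x _ [n nx]].
- by exists 3%N; rewrite -[comm_rel v w]mulr1; apply/relspan_relM/deg_lt1.
- by exists 0%N; apply: relspan0.
- exists (maxn m n); apply: relspanD; [apply: relspanW mx|apply: relspanW ny].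
    exact: leq_maxl.
  exact: leq_maxr.
- move: y; apply: (mon_ind B) => [|y z [m my] [l lz]|c y [m my]|s g].
  + by exists 0%N; rewrite mul0r; apply: relspan0.
  + exists (maxn m l); rewrite mulrDl.
    apply: relspanD; [apply: relspanW my|apply: relspanW lz].
      exact: leq_maxl.
    exact: leq_maxr.
  + by exists m; rewrite -scalerAl; apply: relspanZ.
  elim: s => [|i s [m IHs]].
    by exists n; rewrite mon_nil; apply: relspan_grp.
  by exists m.+1; rewrite mon_cons -mulrA; apply: relspan_letter.
have [m my] := exists_deg_lt y.
by exists (n + m)%N; apply: relspanMr my; apply: relspanW nx.
Qed.

Theorem ideal_deg_lt n x :
  ideal_gen defining_rel x -> deg_lt n x -> relspan n x.
Proof. by move=> /ideal_relspan[m mx]; apply: relspan_deg_lt mx. Qed.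

Lemma relspan_ideal n x : relspan n x -> ideal_gen defining_rel x.
Proof.
elim=> {n x} [n|n x y _ ? _ ?|n c x _ ?|n i j s g _|n i x _ ?].
- exact: Ideal0.
- exact: IdealD.
- by rewrite -mulr_algl; apply: IdealMl.
- by apply/IdealMr/IdealGen; do 2!eexists.
exact: IdealMl.
Qed.

(** Two words with the same letters sort to the same word, so they differ, modulo
    the ideal, by their corrections. *)
Lemma perm_mon s s' g : perm_eq s s' ->
  exists2 z, deg_lt (size s) z & ideal_gen defining_rel (mon s g - mon s' g - z).
Proof.
move=> ss'; have sz : deg_lt (size s) (sort_corr s - sort_corr s').
  by apply: deg_ltB; last rewrite (perm_size ss'); apply: deg_lt_sort_corr.
exists ((sort_corr s - sort_corr s') * grp g).
  case: (size s) sz => [/deg_lt_eq0->|n nz]; first by rewrite mul0r; apply: deg_lt0.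
  by rewrite -addn1; apply: deg_ltM => //; rewrite -mon_nil; apply: deg_lt_mon.
have -> : mon s g - mon s' g - (sort_corr s - sort_corr s') * grp g =
   ((word_val s - word_val (isort s) - sort_corr s)
    - (word_val s' - word_val (isort s') - sort_corr s')) * grp g.
  rewrite /mon (perm_isort ss'); noncomm_ring.
apply/IdealMr/(relspan_ideal (n := (size s).+1)).
by apply: relspanB; last rewrite (perm_size ss'); apply: sort_corrP.
Qed.
End Reduction.

(** * Symbols in the associated graded algebra *)

Section Symbols.
Variables (k : fieldType) (R : algType k) (X : R -> Prop) (F : filtration R).

Lemma qalg_proj_fil n x : x \in F n -> qalg_proj X x \in qfil F n.
Proof. by move=> Fx; apply/asboolP; exists x. Qed.

Lemma filB n x y : x \in F n -> y \in F n -> x - y \in F n.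
Proof. by move=> Fx Fy; rewrite -scaleN1r rpredD ?rpredZ. Qed.

Definition symb n x (Fx : x \in F n.+1) : gr_comp X F n :=
  gr_sym (qalg_proj_fil Fx).

Lemma symb_onto n (Z : gr_comp X F n) : exists x, exists Fx : x \in F n.+1, Z = symb Fx.
Proof.
have /asboolP[x Fx Ex] := valP (repr Z); exists x; exists Fx.
by rewrite -[LHS]gr_symE; apply/gr_symP; rewrite Ex subrr rpred0.
Qed.

(** The elements of degree at most n whose class vanishes in the component of
    degree n of the associated graded algebra, see [symbP]. *)
Definition near_ideal n x := exists2 z, z \in F n & ideal_gen X (x - z).

Lemma symbP n x y (Fx : x \in F n.+1) (Fy : y \in F n.+1) :
  symb Fx = symb Fy <-> near_ideal n (x - y).
Proof.
have projB : qalg_proj X x - qalg_proj X y = qalg_proj X (x - y).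
  by apply: (addIr (qalg_proj X y)); rewrite -qalg_projD !subrK.
split=> [/gr_symP|[z Fz Iz]].
  rewrite projB => /asboolP[z Fz /qprojP/asboolP Iz]; exists z => //.
  by rewrite -opprB -mulN1r; apply: IdealMl.
apply/gr_symP; rewrite projB; apply/asboolP; exists z => //.
by apply/qprojP/asboolP; rewrite -opprB -mulN1r; apply: IdealMl.
Qed.

Lemma symb_linear n c x y (Fx : x \in F n.+1) (Fy : y \in F n.+1)
    (Fxy : c *: x + y \in F n.+1) :
  symb Fxy = c *: symb Fx + symb Fy.
Proof.
pose S z (Fz : z \in F n.+1) : subsp (qfil (X := X) F n.+1) :=
  Sub (qalg_proj X z) (qalg_proj_fil Fz).
transitivity (qproj (qfil_prev (X := X) (F := F) (n := n)) (c *: S x Fx + S y Fy)).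
  congr qproj; apply: val_inj; rewrite SubK [RHS]linearP [LHS]qalg_projD.
  by congr (_ + _); symmetry; apply: qscale_proj.
by rewrite qprojD; congr (_ + _); symmetry; apply: qscale_proj.
Qed.

Lemma symbM m n x y (Fx : x \in F m.+1) (Fy : y \in F n.+1)
    (Fxy : x * y \in F (m + n).+1) :
  gr_mul (symb Fx) (symb Fy) = symb Fxy.
Proof.
by rewrite [LHS]gr_mul_sym; apply/gr_symP; rewrite -qalg_projM subrr rpred0.
Qed.

Section Iso.
Variables (B : gradedAlg k) (sigma : forall n, R -> B n).
Hypothesis sigma_linear : forall n, linear (@sigma n).
Hypothesis sigma_ker : forall n x, x \in F n.+1 -> @sigma n x = 0 <-> near_ideal n x.
Hypothesis sigma_onto : forall n (b : B n), exists2 x, x \in F n.+1 & sigma n x = b.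
Hypothesis sigma1 : sigma 0 1 = gone B.
Hypothesis sigmaM : forall m n x y, x \in F m.+1 -> y \in F n.+1 ->
  sigma (m + n) (x * y) = gmul (sigma m x) (sigma n y).

Lemma sigmaB n x y : sigma n (x - y) = sigma n x - sigma n y.
Proof.
have -> : x - y = -1 *: y + x by rewrite scaleN1r addrC.
by rewrite sigma_linear scaleN1r addrC.
Qed.

(** An isomorphism out of the associated graded algebra is a family of symbol
    maps defined on the filtered algebra itself, with the right kernels; it is
    evaluated on a class through a chosen representative. *)
Definition symb_rep n (Z : gr_comp X F n) : R := sval (cid (symb_onto Z)).
Definition symb_map n (Z : gr_comp X F n) : B n := sigma n (symb_rep Z).

Lemma symb_mapE n x (Fx : x \in F n.+1) : symb_map (symb Fx) = sigma n x.
Proof.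
rewrite /symb_map /symb_rep; case: cid => y [Fy /= /symbP xy].
have Fxy : x - y \in F n.+1 by exact: filB.
by apply/esym/subr0_eq; rewrite -sigmaB; apply/(sigma_ker Fxy).
Qed.

Fact symb_map_linear n : linear (@symb_map n).
Proof.
move=> c Z1 Z2; have [x [Fx ->]] := symb_onto Z1; have [y [Fy ->]] := symb_onto Z2.
have Fxy : c *: x + y \in F n.+1 by rewrite rpredD ?rpredZ.
by rewrite -(symb_linear Fx Fy Fxy) !symb_mapE sigma_linear.
Qed.
HB.instance Definition _ n :=
  GRing.isLinear.Build k (gr_comp X F n) (B n) _ (@symb_map n) (@symb_map_linear n).

Lemma symb_map_bij n : bijective (@symb_map n).
Proof.
have invP b : {Z : gr_comp X F n | symb_map Z = b}.
  apply: cid; have [x Fx <-] := sigma_onto b.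
  by exists (symb Fx); rewrite symb_mapE.
exists (fun b => sval (invP b)) => [Z|b]; last exact: (svalP (invP b)).
case: (invP _) => Z' /= ; have [x [Fx ->]] := symb_onto Z.
have [y [Fy ->]] := symb_onto Z'; rewrite !symb_mapE => yx.
have Fyx : y - x \in F n.+1 by exact: filB.
by apply/symbP/(sigma_ker Fyx); rewrite sigmaB yx subrr.
Qed.

Lemma assoc_graded_iso : graded_isomorphic (assoc_graded X F) B.
Proof.
exists (fun n => symb_map (n := n)); split=> /= [n||m n Z1 Z2].
- exact: symb_map_bij.
- have -> : gr_sym (qfil1 X F) = symb (fil1 F) by apply/gr_symP; rewrite subrr rpred0.
  by rewrite symb_mapE.
have [x [Fx ->]] := symb_onto Z1; have [y [Fy ->]] := symb_onto Z2.
have Fxy := filM Fx Fy.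
by rewrite (symbM Fx Fy Fxy) !symb_mapE sigmaM.
Qed.
End Iso.

(** Dimension count in degree n.  The composite of [c], of the passage to the
    associated graded algebra, of an isomorphism with [B] and of [theta] is a
    surjective endomorphism of the finite-dimensional space W, hence it is
    injective.  The isomorphism is an arbitrary one. *)
Lemma assoc_graded_inj (B : gradedAlg k) n (W : vectType k)
    (theta : {linear B n -> W}) (c : {linear W -> R}) :
  graded_isomorphic (assoc_graded X F) B ->
  (forall w, exists b, theta b = w) ->
  (forall w, c w \in F n.+1) ->
  (forall x, x \in F n.+1 -> exists w, x - c w \in F n) ->
  forall w, near_ideal n (c w) -> w = 0.
Proof.
case=> phi [phi_bij _ _] theta_onto cF c_onto.
pose e w := theta (phi n (symb (cF w))).
have eL : linear e.
  move=> t u v; rewrite /e -!linearP; congr (theta (phi n _)).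
  have Fuv : t *: c u + c v \in F n.+1 by rewrite rpredD ?rpredZ.
  rewrite -(symb_linear _ _ Fuv); apply/symbP.
  by exists 0; rewrite ?rpred0 // linearP subrr subr0; apply: Ideal0.
pose eH : {linear W -> W} := HB.pack e (GRing.isLinear.Build k W W _ e eL).
pose E := linfun eH.
have e_onto u : exists w, e w = u.
  have [b <-] := theta_onto u; have [Z <-] : exists Z, phi n Z = b.
    by have [psi _ psiK] := phi_bij n; exists (psi b).
  have [x [Fx ->]] := symb_onto Z; have [w Fxw] := c_onto x Fx.
  exists w; rewrite /e; congr (theta (phi n _)); apply/symbP.
  exists (c w - x); first by rewrite -opprB -scaleN1r rpredZ.
  by rewrite subrr; apply: Ideal0.
have limgE : limg E = fullv.
  apply/eqP; rewrite eqEsubv subvf; apply/subvP => u _.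
  by have [w <-] := e_onto u; apply/memv_imgP; exists w; rewrite ?memvf // lfunE.
have kerE : lker E == 0%VS.
  have := limg_ker_dim E fullv; rewrite capfv limgE -[X in _ = X]add0n => /addIn/eqP.
  by rewrite dimv_eq0.
move=> w Iw; apply: (lker0P kerE); rewrite !lfunE.
have -> : eH 0 = 0 := linear0 eH; rewrite /= /e.
have F0 : 0 \in F n.+1 by rewrite rpred0.
have -> : symb (cF w) = symb F0 by apply/symbP; rewrite subr0.
suff -> : symb F0 = 0 by rewrite !linear0.
have F00 : -1 *: 0 + 0 \in F n.+1 by rewrite scaler0 addr0.
have <- : symb F00 = symb F0.
  by apply/symbP; exists 0; rewrite ?rpred0 // scaler0 !subr0 addr0; apply: Ideal0.
by rewrite (symb_linear F0 F0) scaleN1r addNr.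
Qed.
End Symbols.

(** * The basis of words and group elements of T(V) # G *)

Section SkewTens.
Variables (k : fieldType) (G : finGroupType) (A : algType k) (alpha : algAction G A).

Definition skew_emb g x : skewAlg alpha := skew_tens alpha x g.

Fact skew_emb_linear g : linear (skew_emb g).
Proof.
move=> c x y; apply/ffunP => h; rewrite !ffunE.
by case: ifP => _; rewrite ?scaler0 ?addr0.
Qed.
HB.instance Definition _ g :=
  GRing.isLinear.Build k A (skewAlg alpha) _ (skew_emb g) (skew_emb_linear g).

End SkewTens.

Section MalgSpan.
Variables (k : fieldType) (M : monomType).

Lemma malg_span (x : {malg k[M]}) : x = \sum_(m <- msupp x) x@_m *: << m >>.
Proof. by rewrite [LHS]monalgE; apply: eq_bigr => m _; rewrite malgUZ. Qed.

Variables (A : algType k) (phi : M -> A).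
Definition malg_lin (x : {malg k[M]}) : A := mmap (in_alg A) phi x.
Fact malg_lin_linear : linear malg_lin.
Proof.
move=> c x y; rewrite /malg_lin [LHS]mmapD; congr (_ + _).
rewrite (mmapEw (msuppZ_le c x)) mmapE scaler_sumr; apply: eq_bigr => m _ /=.
by rewrite mcoeffZ -scalerA scalerAl.
Qed.
HB.instance Definition _ :=
  GRing.isLinear.Build k {malg k[M]} A _ malg_lin malg_lin_linear.
Lemma malg_linU m : malg_lin << m >> = phi m.
Proof. by rewrite /malg_lin mmapU /= scale1r mul1r. Qed.
End MalgSpan.

Section SkewTensor.
Variables (k : fieldType) (G : finGroupType) (V : vectType k) (rho : linAction G V).
Local Notation TG := (skewAlg (tensor_action rho)).
Local Notation I := 'I_(\dim {:V}).
Local Notation word := (seq I).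

Fact skew_vec_linear : linear (@skew_vec k G V rho).
Proof. move=> c u v; rewrite /skew_vec linearP; exact: skew_emb_linear. Qed.
HB.instance Definition _ :=
  GRing.isLinear.Build k V TG _ (@skew_vec k G V rho) skew_vec_linear.

Lemma skew_grp1 : skew_grp rho 1%g = 1.
Proof. by []. Qed.
Lemma skew_grpM g h : skew_grp rho (g * h)%g = skew_grp rho g * skew_grp rho h.
Proof. by rewrite [RHS]skew_mul_tens rmorph1 mulr1. Qed.

Definition skew_covariant : covariant rho TG :=
  Covariant skew_grp1 skew_grpM (@skew_grp_vec k G V rho).
Local Notation C := skew_covariant.
Local Notation word_val := (word_val C).
Local Notation mon := (mon C).
Local Notation letter := (letter C).

Lemma word_valE s : word_val s = skew_tens (tensor_action rho) << FMonom s >> 1%g.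
Proof.
elim: s => [|i s IHs].
  have -> : FMonom [::] = mone :> {fmonom I} by apply: val_inj; rewrite /= fm1.
  exact: big_nil.
rewrite word_val_cons IHs /letter [LHS]skew_mul_tens tensor_vec_basis mulg1.
congr (skew_tens _ _ _); rewrite tensor_act1 [LHS]fgmulUU mulr1; congr (<< _ >>).
by apply/val_inj; rewrite /= fmM fmU.
Qed.

Lemma monE s g : mon s g = skew_tens (tensor_action rho) << FMonom s >> g.
Proof. by rewrite /mon word_valE [LHS]skew_mul_tens rmorph1 mulr1 mul1g. Qed.

Definition tensor_in (D : pred nat) : {pred tensorAlg V} :=
  deg_in (@fdeg 'I_(\dim {:V})) D.
Definition skew_in (D : pred nat) : {pred TG} := skew_pred (tensor_in D).

Lemma skew_span (P : TG -> Prop) (D : pred nat) (x : TG) :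
    P 0 -> (forall x y, P x -> P y -> P (x + y)) -> (forall c x, P x -> P (c *: x)) ->
    x \in skew_in D ->
    (forall s g, D (size s) -> P (mon s g)) -> P x.
Proof.
move=> P0 PD PZ /skew_predP Dx Pmon.
have Psum := @span_sum _ _ _ P0 PD.
rewrite [x]skewE; apply: (Psum _) => g _.
rewrite -/(skew_emb _ g (x g)) (malg_span (x g)) linear_sum big_seq.
apply: (Psum _) => -[m] xm; rewrite linearZ; apply: PZ.
have := Pmon m g; rewrite monE; apply.
by move/allP: (Dx g) => /(_ _ xm).
Qed.

Lemma skew_ind (P : TG -> Prop) :
    P 0 -> (forall x y, P x -> P y -> P (x + y)) -> (forall c x, P x -> P (c *: x)) ->
    (forall s g, P (mon s g)) -> forall x, P x.
Proof.
move=> P0 PD PZ Pmon x; apply: (@skew_span P xpredT) => //.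
by apply/skew_predP => g; apply/allP.
Qed.

Definition skew_lext (phi : word -> TG) (x : TG) : TG :=
  \sum_g malg_lin (fun m : {fmonom I} => phi m) (x g) * skew_grp rho g.

Fact skew_lext_linear phi : linear (skew_lext phi).
Proof.
move=> c x y; rewrite /skew_lext scaler_sumr -big_split; apply: eq_bigr => g _ /=.
by rewrite skewD skewZ linearP mulrDl scalerAl.
Qed.
HB.instance Definition _ phi :=
  GRing.isLinear.Build k TG TG _ (skew_lext phi) (skew_lext_linear phi).

Lemma skew_lext_mon phi s g : skew_lext phi (mon s g) = phi s * skew_grp rho g.
Proof.
rewrite /skew_lext (bigD1 g) //= monE big1 ?addr0 => [|h /negPf hg].
  by rewrite ffunE eqxx malg_linU.
by rewrite ffunE hg linear0 mul0r.
Qed.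

Definition skew_basis : mon_basis C :=
  MonBasis (lext := fun phi => skew_lext phi) skew_lext_mon skew_ind.

Local Notation deg_lt := (deg_lt C).

Lemma deg_ltP n x : reflect (deg_lt n x) (x \in skew_tensor_lt n).
Proof.
apply: (iffP idP) => [nx|].
  apply: (skew_span (D := fun d => (d < n)%N)) nx _; first exact: deg_lt0.
  - by move=> *; apply: deg_ltD.
  - by move=> *; apply: deg_ltZ.
  by move=> *; apply: deg_lt_mon.
elim=> [|y z _ ? _ ?|c y _ ?|s g sn]; first exact: rpred0.
- exact: rpredD.
- exact: rpredZ.
rewrite monE; apply/skew_predP => h; rewrite ffunE.
by case: ifP => _; [apply: deg_inU | rewrite rpred0].
Qed.

End SkewTensor.

(** * Words representing monomials *)

Section MonomialWords.
Variable n : nat.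
Local Notation I := 'I_n.

Definition word_monom (s : seq I) : {cmonom I} := \big[mmul/mone]_(i <- s) ucm i.
Definition monom_word (m : {cmonom I}) : seq I :=
  flatten [seq nseq (m i) i | i <- enum I].

Lemma word_monomE s i : word_monom s i = count_mem i s.
Proof.
elim: s => [|j s IHs]; rewrite /word_monom ?big_nil ?big_cons ?cm1 //.
by rewrite cmM cmU -/(word_monom s) IHs.
Qed.

Lemma count_monom_word m i : count_mem i (monom_word m) = m i.
Proof.
rewrite count_flatten -map_comp sumnE big_map big_enum /= (bigD1 i) //=.
rewrite count_nseq /= eqxx mul1n big1 ?addn0 // => j /negPf ji.
by rewrite /= count_nseq /= ji.
Qed.

Lemma monom_wordK m : word_monom (monom_word m) = m.
Proof. by apply/eqP/cmP => i; rewrite word_monomE count_monom_word. Qed.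

Lemma perm_monom_word s : perm_eq (monom_word (word_monom s)) s.
Proof. by apply/allP => i _ /=; rewrite count_monom_word word_monomE. Qed.

Lemma mdeg_word s : mdeg (word_monom s) = size s.
Proof.
elim: s => [|i s IHs]; rewrite /word_monom ?big_nil ?big_cons ?mdeg1 //.
by rewrite mdegM mdegU -/(word_monom s) IHs.
Qed.

Lemma size_monom_word m : size (monom_word m) = mdeg m.
Proof. by rewrite -mdeg_word monom_wordK. Qed.
End MonomialWords.

Lemma malgUM (k : fieldType) (M : conomType) (m1 m2 : M) :
  << m1 >> * << m2 >> = << mmul m1 m2 >> :> {malg k[M]}.
Proof. by rewrite [LHS]fgmulUU mulr1. Qed.

(** * Homogeneous parts *)

Section DegreePart.
Variables (k : fieldType) (M : monomType) (mf : measure M).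
Implicit Types x y : {malg k[M]}.

Definition deg_part n x : {malg k[M]} :=
  [malg m in msupp x => if mf m == n then x@_m else 0].

Lemma deg_partE n x m : (deg_part n x)@_m = if mf m == n then x@_m else 0.
Proof. by rewrite mcoeffE; case: msuppP => // _; case: ifP. Qed.

Fact deg_part_linear n : linear (deg_part n).
Proof.
move=> c x y; apply/malgP => m; rewrite mcoeffD mcoeffZ !deg_partE.
by case: ifP => _; rewrite ?mulr0 ?addr0 // mcoeffD mcoeffZ.
Qed.
HB.instance Definition _ n :=
  GRing.isLinear.Build k {malg k[M]} {malg k[M]} _ (deg_part n) (deg_part_linear n).

Lemma deg_part_in n x : deg_part n x \in deg_in mf (pred1 n).
Proof. by apply/deg_inP => m; rewrite deg_partE /=; case: ifP => // _; rewrite eqxx. Qed.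

Lemma deg_part_id n x : x \in deg_in mf (pred1 n) -> deg_part n x = x.
Proof.
move=> /deg_inP nx; apply/malgP => m; rewrite deg_partE.
by case: ifP => // /negP nm; apply/esym/eqP/negPn/negP => /nx.
Qed.

Lemma deg_part_eq0 n x : x \in deg_in mf (fun d => d < n)%N -> deg_part n x = 0.
Proof.
move=> /deg_inP nx; apply/malgP => m; rewrite deg_partE mcoeff0.
by case: ifP => // /eqP nm; apply/eqP/negPn/negP => /nx; rewrite nm ltnn.
Qed.

Lemma deg_partP n x : x \in deg_in mf (fun d => d < n.+1)%N ->
  x - deg_part n x \in deg_in mf (fun d => d < n)%N.
Proof.
move=> /deg_inP nx; apply/deg_inP => m; rewrite mcoeffB deg_partE.
have [nm|nm] := eqVneq (mf m) n; first by rewrite subrr eqxx.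
by rewrite subr0 => /nx; rewrite ltnS leq_eqVlt (negPf nm).
Qed.
End DegreePart.

(** * The projection of T(V) # G onto S(V) # G *)

Section SkewPred.
Variables (k : fieldType) (G : finGroupType) (A : algType k) (alpha : algAction G A).
Variable W : submodClosed A.
Implicit Types x y : skewAlg alpha.

Lemma skew_pred0 : 0 \in skew_pred (alpha := alpha) W.
Proof. exact: rpred0. Qed.
Lemma skew_predD x y : x \in skew_pred W -> y \in skew_pred W -> x + y \in skew_pred W.
Proof. exact: rpredD. Qed.
Lemma skew_predZ c x : x \in skew_pred W -> c *: x \in skew_pred W.
Proof. exact: rpredZ. Qed.
Lemma skew_predN x : x \in skew_pred W -> - x \in skew_pred W.
Proof. by rewrite -scaleN1r; apply: skew_predZ. Qed.
Lemma skew_pred_tens a g : a \in W -> skew_tens alpha a g \in skew_pred W.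
Proof. by move=> Wa; apply/skew_predP => h; rewrite ffunE; case: ifP; rewrite ?rpred0. Qed.
End SkewPred.

Section SkewMap.
Variables (k : fieldType) (G : finGroupType) (A A' : algType k).
Variables (alpha : algAction G A) (beta : algAction G A').

Definition skew_map (f : A -> A') (x : skewAlg alpha) : skewAlg beta :=
  [ffun g => f (x g)].

Fact skew_map_linear (f : {linear A -> A'}) : linear (skew_map f).
Proof.
move=> c x y; apply/ffunP => g; rewrite ffunE skewD skewZ [LHS]linearP.
by rewrite [RHS]skewD skewZ !ffunE.
Qed.
HB.instance Definition _ (f : {linear A -> A'}) :=
  GRing.isLinear.Build k (skewAlg alpha) (skewAlg beta) _ (skew_map f) (skew_map_linear f).

Lemma skew_map_tens (f : {linear A -> A'}) x g :
  skew_map f (skew_tens alpha x g) = skew_tens beta (f x) g.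
Proof. by apply/ffunP => h; rewrite !ffunE; case: ifP => _; rewrite ?linear0. Qed.

Lemma skew_mapM (f : {lrmorphism A -> A'}) :
  (forall g x, f (alpha g x) = beta g (f x)) ->
  {morph skew_map f : x y / x * y}.
Proof.
move=> fG x y; apply/ffunP => h; rewrite ffunE [in LHS]ffunE [RHS]ffunE linear_sum.
by apply: eq_bigr => g _; rewrite !ffunE [LHS]rmorphM; congr (_ * _); apply: fG.
Qed.
End SkewMap.

Section SkewSym.
Variables (k : fieldType) (G : finGroupType) (V : vectType k) (rho : linAction G V).
Local Notation TG := (skewAlg (tensor_action rho)).
Local Notation SG := (skewAlg (sym_action rho)).
Local Notation I := 'I_(\dim {:V}).
Local Notation word := (seq I).
Local Notation C := (skew_covariant rho).
Local Notation mon := (mon C).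
Local Notation sdeg := (@mdeg 'I_(\dim {:V})).
Local Notation symv := (tensor_lift (@sym_vec k V)).

Lemma symv_act g x : symv (tensor_act rho g x) = sym_act rho g (symv x).
Proof.
pose p : {lrmorphism tensorAlg V -> symAlg V} := symv \o tensor_act rho g.
pose q : {lrmorphism tensorAlg V -> symAlg V} := sym_act rho g \o symv.
suff pq v : p (tensor_vec v) = q (tensor_vec v) by exact: (tensor_ext pq x).
transitivity (sym_vec (rho g v)).
  transitivity (symv (tensor_vec (rho g v))); last exact: tensor_lift_vec.
  by congr (symv _); apply: tensor_act_vec.
symmetry; transitivity (sym_act rho g (sym_vec v)); last exact: sym_act_vec.
by congr (sym_act rho g _); apply: tensor_lift_vec.
Qed.

Definition skew_sym (x : TG) : SG := skew_map (sym_action rho) symv x.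
HB.instance Definition _ := GRing.isLinear.Build k TG SG _ skew_sym
  (@skew_map_linear _ _ _ _ (tensor_action rho) (sym_action rho) symv).

Lemma skew_sym0 : skew_sym 0 = 0. Proof. exact: linear0. Qed.
Lemma skew_symD x y : skew_sym (x + y) = skew_sym x + skew_sym y.
Proof. exact: linearD. Qed.
Lemma skew_symB x y : skew_sym (x - y) = skew_sym x - skew_sym y.
Proof. exact: linearB. Qed.
Lemma skew_symZ c x : skew_sym (c *: x) = c *: skew_sym x.
Proof. exact: linearZ. Qed.

Lemma skew_symM x y : skew_sym (x * y) = skew_sym x * skew_sym y.
Proof. exact: (@skew_mapM _ _ _ _ (tensor_action rho) (sym_action rho) symv symv_act). Qed.

Lemma skew_sym_tens x g :
  skew_sym (skew_tens (tensor_action rho) x g) = skew_tens (sym_action rho) (symv x) g.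
Proof. exact: (@skew_map_tens _ _ _ _ (tensor_action rho) (sym_action rho) symv). Qed.

Lemma skew_sym_vec v :
  skew_sym (skew_vec rho v) = skew_tens (sym_action rho) (sym_vec v) 1%g.
Proof. by rewrite [LHS]skew_sym_tens; congr skew_tens; apply: tensor_lift_vec. Qed.

Lemma sym_word_vec (s : word) :
  \prod_(i <- s) sym_vec (vbasis {:V})`_i = << word_monom s >> :> symAlg V.
Proof.
elim: s => [|i s IHs]; first by rewrite /word_monom !big_nil.
transitivity (<< ucm i >> * << word_monom s >> : symAlg V).
  by rewrite big_cons; congr (_ * _); first exact: sym_vec_basis.
have -> : word_monom (i :: s) = mmul (ucm i) (word_monom s) by apply: big_cons.
exact: malgUM.
Qed.

Lemma skew_sym_mon s g :
  skew_sym (mon s g) = skew_tens (sym_action rho) << word_monom s >> g.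
Proof.
rewrite monE [LHS]skew_sym_tens; congr skew_tens.
rewrite [LHS]malg_liftU; exact: sym_word_vec.
Qed.

Definition sym_lt n : {pred symAlg V} := deg_in sdeg (fun d => d < n)%N.
HB.instance Definition _ n :=
  GRing.isSubmodClosed.Build k (symAlg V) (sym_lt n) (deg_in_submod k sdeg _).
Definition skew_sym_lt n : {pred SG} := skew_pred (sym_lt n).

Definition skew_part n (x : SG) : SG := skew_map (sym_action rho) (deg_part sdeg n) x.
HB.instance Definition _ n := GRing.isLinear.Build k SG SG _ (skew_part n)
  (@skew_map_linear _ _ _ _ (sym_action rho) (sym_action rho) (deg_part sdeg n)).

Lemma skew_sym_lt0 n : 0 \in skew_sym_lt n.
Proof. exact: (@skew_pred0 k G (symAlg V) (sym_action rho) (sym_lt n)). Qed.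
Lemma skew_sym_ltD n x y :
  x \in skew_sym_lt n -> y \in skew_sym_lt n -> x + y \in skew_sym_lt n.
Proof. exact: (@skew_predD k G (symAlg V) (sym_action rho) (sym_lt n) x y). Qed.
Lemma skew_sym_ltZ n c x : x \in skew_sym_lt n -> c *: x \in skew_sym_lt n.
Proof. exact: (@skew_predZ k G (symAlg V) (sym_action rho) (sym_lt n) c x). Qed.
Lemma skew_sym_ltN n x : x \in skew_sym_lt n -> - x \in skew_sym_lt n.
Proof. exact: (@skew_predN k G (symAlg V) (sym_action rho) (sym_lt n) x). Qed.
Lemma skew_sym_lt_cancel n x y z :
  x = y -> z \in skew_sym_lt n -> x - y - z \in skew_sym_lt n.
Proof. by move=> -> nz; rewrite subrr sub0r; apply: skew_sym_ltN. Qed.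
Lemma skew_sym_lt_tens n y g :
  y \in sym_lt n -> skew_tens (sym_action rho) y g \in skew_sym_lt n.
Proof. exact: (@skew_pred_tens k G (symAlg V) (sym_action rho) (sym_lt n) y g). Qed.
Lemma skew_sym_deg_tens n y g :
  y \in @sym_deg k V n -> skew_tens (sym_action rho) y g \in @skew_sym_deg k G V rho n.
Proof. exact: (@skew_pred_tens k G (symAlg V) (sym_action rho) (@sym_deg k V n) y g). Qed.

Lemma skew_sym_deg_lt n x : deg_lt C n x -> skew_sym x \in skew_sym_lt n.
Proof.
elim=> [|y z _ ny _ nz|c y _ ny|s g sn].
- by rewrite skew_sym0; apply: skew_sym_lt0.
- by rewrite skew_symD; apply: skew_sym_ltD.
- by rewrite skew_symZ; apply: skew_sym_ltZ.
by rewrite skew_sym_mon; apply: skew_sym_lt_tens; apply: deg_inU; rewrite /= mdeg_word.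
Qed.

Lemma sym_span (P : SG -> Prop) (D : pred nat) (y : SG) :
    P 0 -> (forall x y, P x -> P y -> P (x + y)) -> (forall c x, P x -> P (c *: x)) ->
    (forall g, y g \in deg_in sdeg D) ->
    (forall m g, D (mdeg m) -> P (skew_tens (sym_action rho) << m >> g)) -> P y.
Proof.
move=> P0 PD PZ Dy Pmon.
have Psum := @span_sum _ _ _ P0 PD.
rewrite [y]skewE; apply: (Psum _) => g _.
rewrite -/(skew_emb _ g (y g)) (malg_span (y g)) linear_sum big_seq.
apply: (Psum _) => m xm; rewrite linearZ; apply: PZ; apply: Pmon.
by move/allP: (Dy g) => /(_ _ xm).
Qed.

(** A linear section that picks a word for each monomial.  It is not
    multiplicative, but it does not raise degrees. *)
Definition sym_section (y : SG) : TG :=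
  \sum_g malg_lin (fun m => word_val C (monom_word m)) (y g) * skew_grp rho g.

Fact sym_section_linear : linear sym_section.
Proof.
move=> c x y; rewrite /sym_section scaler_sumr -big_split; apply: eq_bigr => g _ /=.
by rewrite skewD skewZ linearP mulrDl scalerAl.
Qed.
HB.instance Definition _ :=
  GRing.isLinear.Build k SG TG _ sym_section sym_section_linear.

Lemma sym_section0 : sym_section 0 = 0. Proof. exact: linear0. Qed.
Lemma sym_sectionD x y : sym_section (x + y) = sym_section x + sym_section y.
Proof. exact: linearD. Qed.
Lemma sym_sectionZ c x : sym_section (c *: x) = c *: sym_section x.
Proof. exact: linearZ. Qed.

Lemma sym_section_tens m g :
  sym_section (skew_tens (sym_action rho) << m >> g) = mon (monom_word m) g.
Proof.
rewrite /sym_section (bigD1 g) //= big1 ?addr0 => [|h /negPf hg]; rewrite ffunE ?eqxx ?hg.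
  by rewrite malg_linU.
by rewrite linear0 mul0r.
Qed.

Lemma sym_sectionK : cancel sym_section skew_sym.
Proof.
move=> y.
apply: (@sym_span (fun z => skew_sym (sym_section z) = z) xpredT) => [|u v Eu Ev|c u Eu||m g _].
- by rewrite sym_section0 skew_sym0.
- by rewrite sym_sectionD skew_symD; congr (_ + _).
- by rewrite sym_sectionZ skew_symZ; congr (_ *: _).
- by move=> g; apply/allP.
by rewrite sym_section_tens skew_sym_mon monom_wordK.
Qed.

Lemma sym_section_deg (D : pred nat) n (y : SG) :
    (forall d, D d -> (d < n)%N) -> (forall g, y g \in deg_in sdeg D) ->
  deg_lt C n (sym_section y).
Proof.
move=> Dn Dy.
apply: (@sym_span (fun z => deg_lt C n (sym_section z)) D) Dy _
  => [|u v Eu Ev|c u Eu|m g Dm].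
- by rewrite sym_section0; apply: deg_lt0.
- by rewrite sym_sectionD; apply: deg_ltD.
- by rewrite sym_sectionZ; apply: deg_ltZ.
by rewrite sym_section_tens; apply: deg_lt_mon; rewrite size_monom_word; apply: Dn.
Qed.

Variables (br : altMap V V) (a : G -> altMap V k^o).

Lemma skew_sym_swap i j s g :
  skew_sym (mon [:: i, j & s] g) = skew_sym (mon [:: j, i & s] g).
Proof.
have ij : word_monom [:: i, j & s] = word_monom [:: j, i & s].
  by apply/eqP/cmP => l; rewrite !word_monomE /= addnCA.
transitivity (skew_tens (sym_action rho) << word_monom [:: i, j & s] >> g).
  exact: skew_sym_mon.
by rewrite ij; symmetry; apply: skew_sym_mon.
Qed.

(** The leading part of a relation is a commutator, which dies in S(V) # G; so
    the image of a multiple of a relation has lower degree than its formal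
    degree. *)
Lemma relspan_skew_sym n x : relspan C br a n.+1 x -> skew_sym x \in skew_sym_lt n.
Proof.
move En : n.+1 => m mx; elim: mx n En => {m x} m.
- by move=> n _; rewrite skew_sym0; apply: skew_sym_lt0.
- move=> x y _ IHx _ IHy n En.
  by rewrite skew_symD; apply: skew_sym_ltD; [apply: IHx | apply: IHy].
- move=> c x _ IHx n En.
  by rewrite skew_symZ; apply: skew_sym_ltZ; apply: IHx.
- move=> i j s g; rewrite addn2 => sm n En; rewrite comm_rel_mon.
  rewrite !skew_symB.
  apply: (skew_sym_lt_cancel (skew_sym_swap i j s g)); apply: skew_sym_deg_lt.
  apply: deg_ltW (_ : (size s).+2 <= n)%N _; first by rewrite -ltnS En.
  by apply/deg_lt_kappa/deg_lt_mon.
move=> i x mx IHx n [En]; case: n En => [|n] En.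
  rewrite -En in mx; rewrite (relspan_eq0 mx) mulr0.
  by rewrite skew_sym0; apply: skew_sym_lt0.
rewrite skew_symM.
apply: (skew_predM (W1 := @sym_deg k V 1) (W2 := sym_lt n)) => [y z|g y||].
- by apply: deg_inM => d e /eqP-> /=.
- exact: sym_act_deg.
- rewrite [skew_sym _]skew_sym_vec; apply: skew_sym_deg_tens; exact: sym_vec_deg.
exact: IHx.
Qed.
End SkewSym.

(** * The PBW theorem *)

Lemma mul_split (R : pzRingType) (x y x0 y0 : R) :
  x * y = x0 * y0 + (x0 * (y - y0) + (x - x0) * y).
Proof. noncomm_ring. Qed.

Lemma ucm_inj (I : choiceType) : injective (@ucm I).
Proof.
move=> i j /(congr1 (fun m : {cmonom I} => m i)); rewrite !cmU eqxx.
by case: eqP.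
Qed.

Lemma mcoeff_sumU (k : fieldType) (M : monomType) (I : finType)
    (c : I -> k) (u : I -> M) i :
  injective u -> (\sum_j c j *: << u j >> : {malg k[M]})@_(u i) = c i.
Proof.
move=> u_inj; rewrite raddf_sum (bigD1 i) //= mcoeffZ mcoeffUU mulr1.
rewrite big1 ?addr0 // => j ji.
by rewrite mcoeffZ mcoeffU (inj_eq u_inj) (negPf ji) mulr0n mulr0.
Qed.

Section PBW.
Variables (k : fieldType) (G : finGroupType) (V : vectType k) (rho : linAction G V).
Local Notation TG := (skewAlg (tensor_action rho)).
Local Notation SG := (skewAlg (sym_action rho)).
Local Notation C := (skew_covariant rho).
Local Notation mon := (mon C).
Local Notation sdeg := (@mdeg 'I_(\dim {:V})).
Local Notation sg_lt := (@skew_sym_lt k G V rho).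
Local Notation sg_deg := (@skew_sym_deg k G V rho).
Local Notation part := (@skew_part k G V rho).
Local Notation sym := (@skew_sym k G V rho).
Local Notation F := (skew_tensor_filtration rho).

Lemma partD n x y : part n (x + y) = part n x + part n y.
Proof. exact: linearD. Qed.

Lemma part_in n (x : SG) : part n x \in sg_deg n.
Proof. by apply/skew_predP => g; rewrite ffunE; apply: deg_part_in. Qed.

Lemma part_id n (x : SG) : x \in sg_deg n -> part n x = x.
Proof.
by move=> /skew_predP nx; apply/ffunP => g; rewrite ffunE; apply/deg_part_id/nx.
Qed.

Lemma part_eq0 n (x : SG) : x \in sg_lt n -> part n x = 0.
Proof.
by move=> /skew_predP nx; apply/ffunP => g; rewrite !ffunE; apply/deg_part_eq0/nx.
Qed.

Lemma partP n (x : SG) : x \in sg_lt n.+1 -> x - part n x \in sg_lt n.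
Proof.
move=> /skew_predP nx; apply/skew_predP => g; rewrite !ffunE.
by apply: deg_partP; apply: nx.
Qed.

Lemma sg_ltM m n p (x y : SG) : (forall i j, i < m -> j < n -> i + j < p)%N ->
  x \in sg_lt m -> y \in sg_lt n -> x * y \in sg_lt p.
Proof.
move=> mnp; apply: (skew_predM (W1 := @sym_lt k V m) (W2 := @sym_lt k V n)
  (W3 := @sym_lt k V p)) => [u v|g u]; last exact: sym_act_deg.
exact: deg_inM.
Qed.

Lemma sg_deg_lt n x : x \in sg_deg n -> x \in sg_lt n.+1.
Proof.
move=> /skew_predP nx; apply/skew_predP => g; apply: deg_inS (nx g) => d /eqP->.
exact: ltnSn.
Qed.

Lemma partM m n (x y : SG) : x \in sg_lt m.+1 -> y \in sg_lt n.+1 ->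
  part (m + n) (x * y) = part m x * part n y.
Proof.
move=> mx ny; set x0 := part m x; set y0 := part n y.
have x0y0 : x0 * y0 \in sg_deg (m + n) by apply: skew_sym_degM; apply: part_in.
have low : x0 * (y - y0) + (x - x0) * y \in sg_lt (m + n).
  apply: skew_sym_ltD.
    apply: sg_ltM (sg_deg_lt (part_in m x)) (partP ny) => i j; rewrite ltnS => im jn.
    by rewrite -addnS leq_add.
  apply: sg_ltM (partP mx) ny => i j im; rewrite ltnS => jn.
  by rewrite -addSn leq_add.
transitivity (part (m + n) (x0 * y0 + (x0 * (y - y0) + (x - x0) * y))).
  by congr part; apply: mul_split.
by rewrite partD (part_id x0y0) (part_eq0 low) addr0.
Qed.

(** The component of degree n of the image in S(V) # G.  On elements of degree
    at most n it is multiplicative ([partM]) and, modulo the ideal, has the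
    elements of lower degree as its kernel ([near_of_symbol],
    [symbol_of_near]). *)
Definition symbol n (x : TG) : subsp (sg_deg n) :=
  Sub (part n (sym x)) (part_in n (sym x)).

Fact symbol_linear n : linear (@symbol n).
Proof.
move=> c x y; apply: val_inj.
rewrite [RHS]linearP /= skew_symD skew_symZ; exact: linearP.
Qed.

Variables (br : altMap V V) (a : G -> altMap V k^o).
Local Notation near := (near_ideal (defining_rel C br a) F).

Lemma near0 n : near n 0.
Proof. by exists 0; rewrite ?rpred0 // subr0; apply: Ideal0. Qed.
Lemma nearD n x y : near n x -> near n y -> near n (x + y).
Proof.
move=> [z nz xz] [t nt yt]; exists (z + t); first exact: rpredD.
by rewrite opprD addrACA; apply: IdealD.
Qed.
Lemma nearZ n c x : near n x -> near n (c *: x).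
Proof.
move=> [z nz xz]; exists (c *: z); first exact: rpredZ.
by rewrite -scalerBr -mulr_algl; apply: IdealMl.
Qed.
Lemma near_deg_lt n x : deg_lt C n x -> near n x.
Proof. by move=> /deg_ltP nx; exists x => //; rewrite subrr; apply: Ideal0. Qed.

(** Going to S(V) # G and back replaces a word by another word with the same
    letters, which costs only lower order terms modulo the ideal; this holds
    whether or not the equations do. *)
Definition defect (x : TG) := x - sym_section (sym x).

Lemma defectD x y : defect (x + y) = defect x + defect y.
Proof. by rewrite /defect skew_symD sym_sectionD opprD addrACA. Qed.
Lemma defectZ c x : defect (c *: x) = c *: defect x.
Proof. by rewrite /defect skew_symZ sym_sectionZ scalerBr. Qed.

Lemma near_defect n x : deg_lt C n.+1 x -> near n (defect x).
Proof.
elim=> [|y z _ ny _ nz|c y _ ny|s g sn].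
- rewrite /defect skew_sym0 sym_section0 subrr; exact: near0.
- rewrite defectD; exact: nearD.
- rewrite defectZ; exact: nearZ.
have -> : defect (mon s g) = mon s g - mon (monom_word (word_monom s)) g.
  congr (_ - _).
  transitivity (sym_section (skew_tens (sym_action rho) << word_monom s >> g)).
    by congr sym_section; apply: skew_sym_mon.
  exact: sym_section_tens.
have := perm_monom_word s; rewrite perm_sym.
move=> /(perm_mon C br a g)[z sz Iz]; exists z => //.
by apply/deg_ltP; apply: deg_ltW sz.
Qed.

Lemma near_of_symbol n x : x \in F n.+1 -> symbol n x = 0 -> near n x.
Proof.
move=> /deg_ltP nx /(congr1 val) /= px0.
have symx : sym x \in sg_lt n.
  have := partP (skew_sym_deg_lt nx); rewrite px0 subr0; exact.
have -> : x = defect x + sym_section (sym x) by rewrite subrK.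
apply: nearD; first exact: near_defect.
by apply/near_deg_lt/(sym_section_deg _ (fun g => skew_predP _ _ symx g)).
Qed.

(** By the equations, the element x - z of the ideal, which has degree at most n,
    is a combination of multiples of relations of formal degree at most n. *)
Lemma symbol_of_near n x : pbw_equations rho br a ->
  x \in F n.+1 -> near n x -> symbol n x = 0.
Proof.
move=> eqs /deg_ltP nx [z /deg_ltP nz Iz].
apply: val_inj => /=; rewrite part_eq0 //.
have -> : x = (x - z) + z by rewrite subrK.
rewrite skew_symD; apply: skew_sym_ltD; last exact: skew_sym_deg_lt.
apply: (relspan_skew_sym (br := br) (a := a)).
apply: (ideal_deg_lt eqs (skew_basis rho) Iz).
by apply: deg_ltB => //; apply: deg_ltW nz.
Qed.

Lemma pbw_sufficient : pbw_equations rho br a ->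
  graded_isomorphic (assoc_graded (defining_rel C br a) F) (skew_sym_graded rho).
Proof.
move=> eqs; apply: (@assoc_graded_iso _ _ _ _ (skew_sym_graded rho) symbol).
- exact: symbol_linear.
- move=> n x Fx; split; first exact: near_of_symbol.
  exact: symbol_of_near.
- move=> n b; exists (sym_section (val b)).
    apply/deg_ltP/(sym_section_deg (D := pred1 n)) => [d /eqP->//|g].
    by move/skew_predP: (valP b); apply.
  apply: val_inj => /=; rewrite sym_sectionK part_id //; exact: valP.
- apply: val_inj => /=.
  transitivity (part 0 1); last by apply: part_id; apply: skew_sym_deg1.
  congr part; transitivity (skew_tens (sym_action rho) (tensor_lift (@sym_vec k V) 1) 1%g).
    exact: skew_sym_tens.
  by congr skew_tens; apply: rmorph1.
move=> m n x y /deg_ltP mx /deg_ltP ny; apply: val_inj => /=.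
rewrite skew_symM; apply: partM; exact: skew_sym_deg_lt.
Qed.

Lemma val_linear n c (x y : subsp (sg_deg n)) g :
  (\val (c *: x + y) : SG) g = c *: (\val x : SG) g + (\val y : SG) g.
Proof. by rewrite -skewZ -skewD; congr (fun_of_fin _ g); apply: linearP. Qed.

Definition scalar_part (b : subsp (sg_deg 0)) : {ffun G -> k^o} :=
  [ffun g => ((\val b : SG) g)@_mone].
Fact scalar_part_linear : linear scalar_part.
Proof.
move=> c x y; apply/ffunP => g; rewrite [RHS]ffunE [X in _ = X + _]ffunE.
rewrite [LHS]ffunE [scalar_part x g]ffunE [scalar_part y g]ffunE.
by transitivity ((c *: (\val x : SG) g + (\val y : SG) g)@_mone);
  [congr mcoeff; apply: val_linear | rewrite mcoeffD mcoeffZ].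
Qed.
HB.instance Definition _ := GRing.isLinear.Build k (subsp (sg_deg 0)) {ffun G -> k^o} _
  scalar_part scalar_part_linear.

Lemma scalar_part_onto w : exists b, scalar_part b = w.
Proof.
pose y : SG := [ffun g => w g *: 1].
have y0 : y \in sg_deg 0.
  by apply/skew_predP => g; rewrite ffunE rpredZ //; apply: deg_in1.
exists (Sub y y0); apply/ffunP => g; rewrite ffunE /= ffunE mcoeffZ mcoeff1 eqxx.
exact: mulr1.
Qed.

Definition vector_part (b : subsp (sg_deg 1)) : {ffun G -> V} :=
  [ffun g => \sum_i ((\val b : SG) g)@_(ucm i) *: (vbasis {:V})`_i].
Fact vector_part_linear : linear vector_part.
Proof.
move=> c x y; apply/ffunP => g; rewrite [RHS]ffunE [X in _ = X + _]ffunE.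
rewrite [LHS]ffunE [vector_part x g]ffunE [vector_part y g]ffunE scaler_sumr -big_split.
apply: eq_bigr => i _; rewrite /= scalerA -scalerDl; congr (_ *: _).
by transitivity ((c *: (\val x : SG) g + (\val y : SG) g)@_(ucm i));
  [congr mcoeff; apply: val_linear | rewrite mcoeffD mcoeffZ].
Qed.
HB.instance Definition _ := GRing.isLinear.Build k (subsp (sg_deg 1)) {ffun G -> V} _
  vector_part vector_part_linear.

Lemma sym_vec_coef (v : V) i : (sym_vec v)@_(ucm i) = coord (vbasis {:V}) i v.
Proof.
pose c j := coord (vbasis {:V}) j v.
exact: (@mcoeff_sumU k {cmonom 'I_(\dim {:V})} 'I_(\dim {:V}) c (@ucm _) i (@ucm_inj _)).
Qed.

Lemma vector_part_onto w : exists b, vector_part b = w.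
Proof.
pose y : SG := [ffun g => sym_vec (w g)].
have y1 : y \in sg_deg 1 by apply/skew_predP => g; rewrite ffunE; apply: sym_vec_deg.
exists (Sub y y1); apply/ffunP => g; rewrite ffunE /= ffunE [RHS]basis_sum.
by apply: eq_bigr => i _; rewrite sym_vec_coef.
Qed.

(** The vector part is killed first, by the count in degree 1; what remains is a
    combination of group elements, to which the count in degree 0 applies. *)
Lemma pbw_separated :
  graded_isomorphic (assoc_graded (defining_rel C br a) F) (skew_sym_graded rho) ->
  forall w c, ideal_gen (defining_rel C br a) (vec_comb C w + grp_comb C c) ->
    w = 0 /\ c = 0.
Proof.
move=> iso w c Iwc.
have w0 : w = 0.
  pose theta : {linear gcomp (skew_sym_graded rho) 1 -> {ffun G -> V}} := vector_part.
  pose c1 : {linear {ffun G -> V} -> TG} := vec_comb C.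
  apply: (@assoc_graded_inj _ _ _ _ _ 1 _ theta c1 iso).
  - exact: vector_part_onto.
  - by move=> u; apply/deg_ltP/deg_lt_vec_comb.
  - by move=> x /deg_ltP/deg_lt2P[u xu]; exists u; apply/deg_ltP.
  exists (- grp_comb C c); last by rewrite opprK.
  by rewrite -scaleN1r rpredZ //; apply/deg_ltP/deg_lt_grp_comb.
split=> //; rewrite {}w0 linear0 add0r in Iwc.
pose theta : {linear gcomp (skew_sym_graded rho) 0 -> {ffun G -> k^o}} := scalar_part.
pose c0 : {linear {ffun G -> k^o} -> TG} := grp_comb C.
apply: (@assoc_graded_inj _ _ _ _ _ 0 _ theta c0 iso).
- exact: scalar_part_onto.
- by move=> u; apply/deg_ltP/deg_lt_grp_comb.
- move=> x /deg_ltP/deg_lt1P[u ->]; exists u; rewrite subrr; exact: rpred0.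
by exists 0; rewrite ?rpred0 ?subr0.
Qed.

Theorem pbw_conditionP :
  lie_orbifold_algebra rho br a <-> pbw_equations rho br a.
Proof.
split=> [pbw|/pbw_sufficient]; last exact.
by apply: (@pbw_equations_necessary _ _ _ _ _ C); apply: pbw_separated.
Qed.
End PBW.

(** * Lie orbifold algebras *)

Section ZeroBracket.
Variables (k : fieldType) (V : vectType k).
Definition zero_bracket (v w : V) : V := 0.
Fact zero_bracket_bilinear : bilinear_for *:%R *:%R zero_bracket.
Proof.
by split=> [u|u] c v w; symmetry; rewrite [RHS]/zero_bracket addr0; apply: scaler0.
Qed.
HB.instance Definition _ := bilinear_isBilinear.Build k V V V *:%R *:%R zero_bracket
  zero_bracket_bilinear.
Definition zero_alt : altMap V V := AltMap (alt_fun := zero_bracket) (fun _ => erefl).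
End ZeroBracket.

Lemma drinfeld_hecke_zero (k : fieldType) (G : finGroupType) (V : vectType k)
    (rho : linAction G V) (a : G -> altMap V k^o) :
  drinfeld_hecke_algebra rho a <-> lie_orbifold_algebra rho (zero_alt V) a.
Proof.
rewrite /drinfeld_hecke_algebra /lie_orbifold_algebra.
suff -> : (fun v w => \sum_g a g v w *: skew_grp rho g) =
  (fun v w => skew_vec rho (zero_alt V v w) + \sum_g a g v w *: skew_grp rho g) by [].
by apply/funext => v; apply/funext => w; rewrite [skew_vec rho _]linear0 add0r.
Qed.

Theorem proposition4p2 (k : fieldType) (char_neq2 : 2%N \notin [pchar k])
    (G : finGroupType) (V : vectType k) (rho : linAction G V)
    (a : G -> altMap V k^o) (br : altMap V V) :
  lie_orbifold_algebra rho br a <->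
  [/\ is_lie_bracket br /\ acts_by_lie_automorphisms rho br,
      drinfeld_hecke_algebra rho a
    & forall (v1 v2 v3 : V) (g : G),
        0 = a g v3 (br v1 v2) + a g v1 (br v2 v3) + a g v2 (br v3 v1)].
Proof.
split.
  case/pbw_conditionP => br_G a_G br_jac a_jac a_twist; split; last first.
  - by move=> x y z g; symmetry; apply: (a_jac g z x y).
  - apply/drinfeld_hecke_zero/pbw_conditionP; split=> //.
    + by move=> g v w; rewrite /= /zero_bracket linear0.
    + by move=> x y z; rewrite /cyclic_sum /= /zero_bracket !addr0.
    by move=> g x y z; rewrite /cyclic_sum /= /zero_bracket !linear0r !addr0.
  by split=> //; split=> // u; apply: alt_diag.
case=> [[[_ br_jac] br_G] /drinfeld_hecke_zero/pbw_conditionP[_ a_G _ _ a_twist] a_jac].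
apply/pbw_conditionP; split=> // g x y z.
by symmetry; apply: (a_jac y z x g).
Qed.
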